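(* Let $H$ be an initial-closed graph with bipartition $\{x_1,\ldots,x_{n-1}\}\cup\{y_1,\ldots,y_{n-1}\}$, and let $(U,S)$ be the output of the algorithm described in the context applied to $H$. Then $$\beta_{2(n-1)-|U|-|S|,\;2(n-1)-|S|}(H)\neq0.$$ In particular, $\mathrm{reg}(H)=\mathrm{im}(H)=|U|$, and $\mathrm{pd}(H)\ge 2(n-1)-(|U|+|S|)$.
   Context: A graph $G$ on $\{1,\ldots,n\}$ (finite, simple) is closed (with respect to this labelling) if whenever $\{i,j\},\{i,k\}$ ($j\ne k$) are edges with either $i<j,i<k$ or $i>j,i>k$, then $\{j,k\}$ is an edge. A cut point of a connected graph is a vertex whose removal disconnects it. Let $G$ be a connected closed graph on $\{1,\ldots,n\}$, $n\ge2$, without cut point. Its initial-closed graph $H$ is the (connected, bipartite) graph with vertices $x_1,\ldots,x_{n-1}$ and (after renaming $y_j$ as $y_{j-1}$) $y_1,\ldots,y_{n-1}$, where $x_i$ is adjacent to $y_{j-1}$ iff $i<j$ and $\{i,j\}\in E(G)$. Put $\mu_i:=n-i-\deg_H(x_i)$. Then $\mu_1\ge\cdots\ge\mu_{n-1}=0$ (with $\mu_{n-2}=0$ when $n\ge3$), $\mu_i\le n-2-i$ for $1\le i\le n-3$, and the edge ideal of $H$ is $I(H)=(x_iy_j\mid 1\le i\le n-1,\ i\le j\le n-1-\mu_i)$. Algorithm producing $(U,S)$. Start with $U=\emptyset$, $S=\emptyset$ and the current graph $K=H$. While $K$ has vertices: let $x_a$ (resp. $y_b$) be the vertex of $K$ of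 largest index among the $x$-vertices (resp. $y$-vertices) of $K$. Add the pair $\{x_a,y_b\}$ to $U$. Let $N=N_K(x_a)\cup N_K(y_b)$ (which contains $x_a$ and $y_b$). Add to $S$ all vertices $y_j$ of $K\setminus N$ whose column in the biadjacency matrix of $K\setminus N$ is zero (i.e. all $y$-vertices isolated in $K\setminus N$). Replace $K$ by $K\setminus(S\cup N)$. Return $(U,S)$ when $K$ is empty. For a graph $H$ and a fixed field $\Bbbk$, $\beta_{i,j}(H)$, $\mathrm{pd}(H)$, $\mathrm{reg}(H)$ denote the graded Betti numbers, projective dimension and regularity of $\Bbbk[V(H)]/I(H)$, where $I(H)$ is the edge ideal and $\mathrm{reg}=\max\{j-i\mid\beta_{i,j}\ne0\}$. $\mathrm{im}(H)$ is the maximum size of an induced matching of $H$, i.e. of a set of pairwise disjoint edges no two of which are joined by an edge of $H$. *)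

(* Defs.v *)
From mathcomp Require Import all_boot all_order all_algebra.
From mathcomp Require Import mpoly.

Set Implicit Arguments.
Unset Strict Implicit.
Unset Printing Implicit Defensive.

Import GRing.Theory.

Section Graphs.

Record sgraph (V : finType) := SGraph {
  adj :> rel V;
  adj_sym : ssrbool.symmetric adj;
  adj_irrefl : irreflexive adj
}.

Definition connected_on (V : finType) (G : sgraph V) (A : {set V}) : Prop :=
  {in A &, forall u v,
     connect [rel a b | [&& a \in A, b \in A & G a b]] u v}.

Definition connected (V : finType) (G : sgraph V) : Prop :=
  connected_on G [set: V].

Definition cut_point (V : finType) (G : sgraph V) (v : V) : Prop :=
  ~ connected_on G [set~ v].

Definition nbhd_in (V : finType) (G : sgraph V) (K : {set V}) (v : V) :
  {set V} := [set w in K | G v w].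

Definition is_edge (V : finType) (G : sgraph V) (e : {set V}) : bool :=
  [exists u, exists v, G u v && (e == [set u; v])].

Definition induced_matching (V : finType) (G : sgraph V) (M : {set {set V}}) :
  bool :=
  [forall e in M, is_edge G e] &&
  [forall e in M, forall f in M, (e != f) ==>
     [disjoint e & f] && [forall u in e, forall v in f, ~~ G u v]].

Definition im (V : finType) (G : sgraph V) : nat :=
  \max_(M : {set {set V}} | induced_matching G M) #|M|.

End Graphs.

(* The vertex labelled l in {1, ..., n} is the element l - 1 of 'I_n; likewise
   x_i and y_i are [inl] and [inr] of i - 1 below. *)
Section InitialClosed.

Definition closed_graph (n : nat) (G : sgraph 'I_n) : Prop :=
  forall i j k : 'I_n, j != k -> G i j -> G i k ->
    ((i < j) && (i < k)) || ((j < i) && (k < i)) -> G j k.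

Definition xlabel (n : nat) (i : 'I_n.-1) : 'I_n :=
  widen_ord (leq_pred n) i.

Lemma ylabel_subproof (n : nat) (j : 'I_n.-1) : j.+1 < n.
Proof. by rewrite -ltn_predRL. Qed.

(* The vertex of H now called y_j is the original y_(j+1), whence the shift. *)
Definition ylabel (n : nat) (j : 'I_n.-1) : 'I_n :=
  Ordinal (ylabel_subproof j).

Definition initial_closed_adj (n : nat) (G : sgraph 'I_n) :
    rel ('I_n.-1 + 'I_n.-1)%type :=
  let xy (i j : 'I_n.-1) :=
    (xlabel i < ylabel j) && G (xlabel i) (ylabel j) in
  fun u v => match u, v with
    | inl i, inr j => xy i j
    | inr j, inl i => xy i j
    | _, _ => false
  end.

Lemma initial_closed_sym (n : nat) (G : sgraph 'I_n) :
  ssrbool.symmetric (initial_closed_adj G).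
Proof. by case=> ? [] ?. Qed.

Lemma initial_closed_irrefl (n : nat) (G : sgraph 'I_n) :
  irreflexive (initial_closed_adj G).
Proof. by case. Qed.

Definition initial_closed (n : nat) (G : sgraph 'I_n) :
    sgraph ('I_n.-1 + 'I_n.-1)%type :=
  SGraph (@initial_closed_sym n G) (@initial_closed_irrefl n G).

End InitialClosed.

Section Algorithm.

Variables (m : nat) (H : sgraph ('I_m + 'I_m)%type).
Local Notation V := ('I_m + 'I_m)%type.

Definition largest_x (K : {set V}) : option 'I_m :=
  [pick a | (inl a \in K) && [forall i, (inl i \in K) ==> (i <= a)]].

Definition largest_y (K : {set V}) : option 'I_m :=
  [pick b | (inr b \in K) && [forall j, (inr j \in K) ==> (j <= b)]].

Definition isolated_y (K : {set V}) : {set V} :=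
  [set v in K | (if v is inr _ then true else false) &&
                (nbhd_in H K v == set0)].

(* The current graph is the subgraph of H induced on K.  For an initial-closed
   graph every pass removes at least x_a and y_b, so #|V| passes suffice to
   empty K, and K contains an x-vertex and a y-vertex as long as it is not
   empty. *)
Fixpoint algorithm_loop (fuel : nat) (K : {set V})
    (U : {set {set V}}) (S : {set V}) : {set {set V}} * {set V} :=
  if fuel is fuel'.+1 then
    match largest_x K, largest_y K with
    | Some a, Some b =>
        let N := nbhd_in H K (inl a) :|: nbhd_in H K (inr b) in
        let S' := S :|: isolated_y (K :\: N) in
        algorithm_loop fuel' (K :\: (S' :|: N))
          ([set inl a; inr b] |: U) S'
    | _, _ => (U, S)
    end
  else (U, S).

Definition algorithm : {set {set V}} * {set V} :=
  algorithm_loop #|{: V}| [set: V] set0 set0.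

End Algorithm.

Section Resolutions.

Local Open Scope ring_scope.

Definition edge_ideal (k : fieldType) (V : finType) (H : sgraph V)
    (p : {mpoly k[#|V|]}) : Prop :=
  exists c : V -> V -> {mpoly k[#|V|]},
    p = \sum_(u : V) \sum_(v : V | H u v)
          c u v * ('X_(enum_rank u) * 'X_(enum_rank v)).

(* Minimal graded free resolution
     0 -> F_len -> ... -> F_1 -> F_0 -> R/I -> 0,   R = k[X_0, ..., X_(m-1)],
   where F_i is the sum of the R(- shift i a), a < rank i, its elements are row
   vectors, and maps act by right multiplication.  R/I is generated in degree
   0, so the shifts of such a resolution are natural numbers.  The map
   F_0 -> R/I is the class modulo I of v |-> v *m aug. *)
Record min_resolution (k : fieldType) (m : nat) (I : {mpoly k[m]} -> Prop) :=
  MinResolution {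
    len : nat;
    rank : nat -> nat;
    rank_len : forall i, (len < i)%N -> rank i = 0%N;
    shift : forall i, 'I_(rank i) -> nat;
    aug : 'cV[{mpoly k[m]}]_(rank 0);
    diff : forall i, 'M[{mpoly k[m]}]_(rank i.+1, rank i);
    aug_homog : forall a, aug a 0 \is (shift a).-homog;
    diff_homog : forall i (a : 'I_(rank i.+1)) (b : 'I_(rank i)),
      if (shift b <= shift a)%N then diff i a b \is (shift a - shift b).-homog
      else diff i a b == 0;
    aug_surj : forall p, exists v : 'rV_(rank 0), I (p - (v *m aug) 0 0);
    exact_aug : forall v : 'rV_(rank 0),
      I ((v *m aug) 0 0) <-> exists w : 'rV_(rank 1), v = w *m diff 0;
    exact_diff : forall i (v : 'rV_(rank i.+1)),
      v *m diff i = 0 <-> exists w : 'rV_(rank i.+2), v = w *m diff i.+1;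
    (* the image of F_(i+1) lies in (X_0, ..., X_(m-1)) F_i *)
    diff_min : forall i (a : 'I_(rank i.+1)) (b : 'I_(rank i)),
      (diff i a b)@_0%MM = 0
  }.

Variables (k : fieldType) (m : nat) (I : {mpoly k[m]} -> Prop).
Implicit Type F : min_resolution I.

Definition betti F (i j : nat) : nat :=
  #|[set a : 'I_(rank F i) | shift a == j]|.

Definition pd F : nat :=
  (\max_(i < (len F).+1 | rank F i != 0) i)%N.

Definition is_reg F (r : int) : Prop :=
  (exists i j : nat, betti F i j != 0%N /\ r = j%:Z - i%:Z) /\
  (forall i j : nat, betti F i j != 0%N -> j%:Z - i%:Z <= r).

End Resolutions.

(* Main.v *)
Require Import Defs.
From mathcomp Require Import all_boot all_order all_algebra.
From mathcomp Require Import mpoly.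

Set Implicit Arguments.
Unset Strict Implicit.
Unset Printing Implicit Defensive.

Import GRing.Theory.

(** Write R for the polynomial ring on the vertices, I for the edge ideal, and
index the Koszul complex by sets of vertices: a family [c : {set V} -> M] stands
for the element of the exterior algebra tensored with M whose coefficient at the
wedge e_A is [c A].

Betti numbers are read off from the Koszul complex of R/I. In the double complex
of a minimal resolution F and the Koszul complex, the rows are exact away from
the last column because the Koszul complex of R is exact in positive degrees
([koszul_exact], from the explicit contraction [koszul_homotopy]), and minimality
says that the differential of F vanishes modulo the variables. A diagram chase
in both directions shows that a generator of F_i of degree j exists when some
Koszul cycle over R/I of bidegree (i, j) is not a boundary ([betti_of_koszul]),
and that none exists when all such cycles are boundaries
([betti_eq0_of_koszul]).

A closed connected graph is an interval graph for its labelling: if i < j are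
adjacent then all of i, ..., j are pairwise adjacent ([adj_interval]). Hence x_i
is adjacent to y_j in H only for i <= j, and then also x_i' to y_j' whenever
i <= i' <= j' <= j ([initial_closed_staircase]).

Upper bound for the regularity. Let y_b be the last y with a neighbour and x_q
the first neighbour of y_b. By the staircase shape the edge x_q y_b can be added
to each induced matching that avoids the neighbours of x_q
([staircase_peelable]). The exact sequence relating I, I + (x_q) and the colon
ideal of x_q ([koszul_vanish_step]) then gives, by induction on the number of
vertices, that the Koszul homology of R/I in bidegree (i, j) vanishes when j - i
exceeds the size of every induced matching ([koszul_vanish_matching]).

Algorithm. Each pass removes a block N in which every x is adjacent to every y,
an induced matching of what remains has at most one edge meeting N, and the edge
put into U is separated from everything that remains ([decomposition_step]). So
U is an induced matching of maximum size and the blocks partition the complement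
sigma of S.

Nonvanishing. The sum over all ways of choosing one x in each block, with a
suitable sign, of the wedge of the complement in sigma times the monomial of the
choice is a Koszul cycle over R/I: adjoining a y to a choice creates an edge,
and the two ways of reaching a set with two x in the same block cancel
([block_cycle_closed]). It is not a boundary, for it pairs to a unit with the
fundamental cycle of the cross-polytope spanned by the edges of U
([block_cycle_nonboundary]). Its bidegree is (#|sigma| - #|U|, #|sigma|). *)

(** * Selecting and shifting monomials *)

Section Extract.
Local Open Scope ring_scope.

Variables (k : fieldType) (n : nat).
Implicit Types (p q : {mpoly k[n]}) (m : 'X_{1..n}).

(** Selecting monomials (with [u = 0]), taking homogeneous parts and dividing by a
variable whatever is divisible by it are all of this form. *)
Definition extract (Q : pred 'X_{1..n}) (u : 'X_{1..n}) p : {mpoly k[n]} :=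
  \sum_(m : 'X_{1..n < msize p}) (if Q m then p@_(m + u) else 0) *: 'X_[m].

Lemma mcoeff_extract Q u p m :
  (extract Q u p)@_m = if Q m then p@_(m + u) else 0.
Proof.
case: (ltnP (mdeg m) (msize p)) => [lt_m | le_m].
  by rewrite /extract (mcoeff_mpoly (fun m => if Q m then p@_(m + u) else 0)).
have -> : p@_(m + u) = 0.
  by apply/memN_msupp_eq0/msize_mdeg_ge; rewrite mdegD (leq_trans le_m) ?leq_addr.
rewrite if_same /extract raddf_sum big1 //= => m' _.
rewrite mcoeffZ mcoeffX; case: eqP => [eq_m|]; last by rewrite mulr0.
by have:= bmdeg m'; rewrite eq_m ltnNge le_m.
Qed.

Lemma mcoeffXM (i : 'I_n) p m :
  ('X_i * p)@_m = if (0 < m i)%N then p@_(m - U_(i)) else 0.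
Proof.
rewrite mulrC; case: ifPn => [m_i|].
  have le_im : (U_(i) <= m)%MM by rewrite lep1mP -lt0n.
  by rewrite -{1}(submK le_im) addmC mcoeffMX.
move=> m_i; apply: memN_msupp_eq0; apply/negP.
rewrite (perm_mem (msuppMX _ _)) => /mapP[m' _ eq_m].
by move: m_i; rewrite eq_m mnmDE mnm1E eqxx.
Qed.

Lemma mcoeffMsign j p m : ((-1) ^+ j * p)@_m = (-1) ^+ j * p@_m.
Proof. by rewrite raddfMsign. Qed.

Lemma extractD Q u p q : extract Q u (p + q) = extract Q u p + extract Q u q.
Proof.
apply/mpolyP => m; rewrite mcoeffD !mcoeff_extract mcoeffD.
by case: ifP => // _; rewrite addr0.
Qed.

Lemma extract0 Q u : extract Q u (0 : {mpoly k[n]}) = 0.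
Proof. by apply/mpolyP => m; rewrite mcoeff_extract !mcoeff0 if_same. Qed.

Lemma extract_sign Q u j p : extract Q u ((-1) ^+ j * p) = (-1) ^+ j * extract Q u p.
Proof.
apply/mpolyP => m; rewrite mcoeffMsign !mcoeff_extract mcoeffMsign.
by case: ifP => // _; rewrite mulr0.
Qed.

Lemma extractB Q u p q : extract Q u (p - q) = extract Q u p - extract Q u q.
Proof.
apply/mpolyP => m; rewrite mcoeffB !mcoeff_extract mcoeffB.
by case: ifP => // _; rewrite subr0.
Qed.

Lemma extract_sum (I : Type) (r : seq I) (P : pred I) (F : I -> {mpoly k[n]}) Q u :
  extract Q u (\sum_(i <- r | P i) F i) = \sum_(i <- r | P i) extract Q u (F i).
Proof. exact: (big_morph _ (extractD Q u) (extract0 Q u)). Qed.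

End Extract.

(** * The Koszul differential *)

Section Koszul.
Local Open Scope ring_scope.

Variables (k : fieldType) (V : finType).
Local Notation R := {mpoly k[#|V|]}.
Local Notation mon := 'X_{1..#|V|}.
Local Notation rk := (@enum_rank V).
Implicit Types (v w u : V) (A B T : {set V}).

Definition var v : R := 'X_(rk v).

(** Counting the elements above [v] makes the sign trivial when [v] is larger than
all of [A]. *)
Definition sgn_exp v A : nat := #|[set w in A | (rk v < rk w)%N]|.

Lemma sgn_expU1 v w A :
  w \notin A -> sgn_exp v (w |: A) = ((rk v < rk w)%N + sgn_exp v A)%N.
Proof.
move=> wA; rewrite /sgn_exp; case: (boolP (rk v < rk w)%N) => lt_vw /=.
  have -> : [set x in w |: A | (rk v < rk x)%N]
            = w |: [set x in A | (rk v < rk x)%N].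
    by apply/setP=> x; rewrite !inE; case: eqP => //= ->.
  by rewrite cardsU1 inE (negbTE wA).
apply: eq_card => x; rewrite !inE.
by case: eqP => // ->; rewrite (negbTE lt_vw) (negbTE wA).
Qed.

Section Differential.

Variable M : lmodType R.
Implicit Types c : {set V} -> M.

(** The Koszul differential on the variables of [T]; the coefficient of the image
at e_A collects the sets obtained from [A] by adjoining one vertex. *)
Definition koszul T c A : M :=
  \sum_(v in T | v \notin A) ((-1) ^+ sgn_exp v A * var v) *: c (v |: A).

Lemma eq_koszul T c c' A : c =1 c' -> koszul T c A = koszul T c' A.
Proof. by move=> eq_c; apply: eq_bigr => v _; rewrite eq_c. Qed.

Lemma koszulB T c c' A :
  koszul T (fun B => c B - c' B) A = koszul T c A - koszul T c' A.
Proof.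
by rewrite -sumrB; apply: eq_bigr => v _; rewrite scalerBr.
Qed.

Lemma koszulD T c c' A :
  koszul T (fun B => c B + c' B) A = koszul T c A + koszul T c' A.
Proof.
by rewrite -big_split; apply: eq_bigr => v _; rewrite scalerDr.
Qed.

Lemma koszulZ T a c A : koszul T (fun B => a *: c B) A = a *: koszul T c A.
Proof.
by rewrite scaler_sumr; apply: eq_bigr => v _; rewrite !scalerA mulrC.
Qed.

(** The two orders in which a pair of vertices can be adjoined carry opposite
signs. *)
Lemma koszul_koszul T c A : koszul T (koszul T c) A = 0.
Proof.
(* [F] and [G]: the ordered pairs that are adjoined, and their terms. *)
pose F (x : V * V) := [&& x.1 \in T, x.2 \in T, x.1 \notin A, x.2 \notin A
    & x.1 != x.2].
pose G (x : V * V) := ((-1) ^+ (sgn_exp x.1 A + sgn_exp x.2 (x.1 |: A)) * (var x.1 *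
    var x.2))
        *: c (x.2 |: (x.1 |: A)).
have -> : koszul T (koszul T c) A = \sum_(x | F x) G x.
  rewrite /koszul; under eq_bigr do rewrite scaler_sumr.
  rewrite pair_big_dep /=; apply: eq_big => [[v w]|[v w] _] /=.
    rewrite /F /= in_setU1 negb_or eq_sym.
    by case: (v \in T); case: (w \in T); case: (v \notin A);
       case: (w \notin A); case: eqP.
  by rewrite /G scalerA exprD /= !mulrA; congr (_ *: _); rewrite -!mulrA;
     congr (_ * _); rewrite mulrCA.
rewrite (bigID (fun x : V * V => (rk x.1 < rk x.2)%N)) /=.
rewrite [X in _ + X](reindex_inj (inv_inj (@swap_pairK V V))) /=.
have -> : \sum_(j | F (swap_pair j) && ~~ (rk (swap_pair j).1 < rk (swap_pair j).2)%N)
   G (swap_pair j) = \sum_(x | F x && (rk x.1 < rk x.2)%N) G (swap_pair x).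
  apply: eq_bigl => -[v w]; rewrite /F /= -leqNgt.
  rewrite [RHS]andbC ltn_neqAle (inj_eq val_inj) (inj_eq enum_rank_inj) (eq_sym w).
  by case: (v \in T); case: (w \in T); case: (v \notin A);
     case: (w \notin A); case: eqP => //=; rewrite ?andbF ?andbT.
rewrite -big_split big1 //= => -[v w] /andP[/and5P[/= _ _ vA wA neq_vw] lt_vw].
rewrite /G /= setUCA -scalerDl !sgn_expU1 // lt_vw ltnNge ltnW //= add0n add1n addnS.
by rewrite exprS mulN1r mulNr (addnC (sgn_exp w A)) (mulrC (var w)) subrr scale0r.
Qed.

End Differential.

(** The regular module is hidden here, so that scalars and coefficients are both
plain polynomials. *)
Definition koszulR T (c : {set V} -> R) A : R := koszul T (c : {set V} -> R^o) A.

Lemma koszulRE T c A :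
  koszulR T c A = \sum_(v in T | v \notin A) (-1) ^+ sgn_exp v A * (var v * c (v |: A)).
Proof. by apply: eq_bigr => v _; rewrite /GRing.scale /= mulrA. Qed.

End Koszul.

(** * A contraction of the Koszul complex *)

Section Homotopy.
Local Open Scope ring_scope.

Variables (k : fieldType) (V : finType) (T : {set V}).
Local Notation R := {mpoly k[#|V|]}.
Local Notation mon := 'X_{1..#|V|}.
Local Notation rk := (@enum_rank V).
Implicit Types (v w u : V) (A B : {set V}) (p : R) (m : mon).

Definition clear v m : bool := [forall w in T, (rk v < rk w)%N ==> (m (rk w) == 0%N)].

Lemma clearP v m :
  reflect (forall w, w \in T -> (rk v < rk w)%N -> m (rk w) = 0%N) (clear v m).
Proof.
apply: (iffP forall_inP) => [cl w wT vw | cl w wT].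
  by have /implyP/(_ vw)/eqP := cl w wT.
by apply/implyP => vw; rewrite cl.
Qed.

(** Divides by [v] the part of [p] whose largest variable in [T] is [v]; the parts
for varying [v] are disjoint, which is why no division by integers is needed. *)
Definition cut v p : R := extract (clear v) U_(rk v) p.

Lemma cut_var_above u v p : u \in T -> (rk v < rk u)%N -> cut v (var k u * p) = 0.
Proof.
move=> uT lt_vu; apply/mpolyP => m; rewrite mcoeff_extract mcoeff0 mcoeffXM.
case: ifP => // /clearP/(_ u uT lt_vu) m_u.
rewrite mnmDE m_u mnm1E (inj_eq enum_rank_inj).
by case: eqP lt_vu => // ->; rewrite ltnn.
Qed.

Lemma cut_var_below u v p : (rk u < rk v)%N -> cut v (var k u * p) = var k u * cut v p.
Proof.
move=> lt_uv; apply/mpolyP => m.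
have neq_uv : (v == u) = false by case: eqP lt_uv => // ->; rewrite ltnn.
rewrite mcoeff_extract !mcoeffXM mcoeff_extract mnmDE mnm1E (inj_eq enum_rank_inj).
rewrite neq_uv addn0; case: (posnP (m (rk u))) => m_u; first by rewrite if_same.
have le_um : (U_(rk u) <= m)%MM by rewrite lep1mP -lt0n.
have -> : clear v m = clear v (m - U_(rk u))%MM.
  rewrite /clear; apply: eq_forallb => w; case: (w \in T) => //=.
  case: (ltnP (rk v) (rk w)) => //= lt_vw.
  rewrite mnmBE mnm1E (inj_eq enum_rank_inj).
  case: (eqVneq u w) => [eq_uw|_] /=; last by rewrite subn0.
  by move: lt_vw; rewrite -eq_uw ltnNge ltnW.
by case: ifP => // _; rewrite [(m + _)%MM]addmC -addmBA // addmC.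
Qed.

Lemma cut_varE v p : cut v (var k v * p) = extract (clear v) 0%MM p.
Proof.
apply/mpolyP => m; rewrite !mcoeff_extract mcoeffXM addm0 mnmDE mnm1E eqxx addn1 /=.
by rewrite addmK.
Qed.

(** A monomial in which some [v] of [T] satisfying [P] occurs is recovered exactly
once, from the largest such [v]. *)
Lemma sum_cut (P : pred V) p :
  {in T &, forall u v, P u -> (rk u < rk v)%N -> P v} ->
  \sum_(v in T | P v) var k v * cut v p
    = p - extract (fun m => [forall w in T, P w ==> (m (rk w) == 0%N)]) 0%MM p.
Proof.
move=> P_up; apply/mpolyP => m.
rewrite mcoeffB mcoeff_extract addm0 raddf_sum /=.
transitivity (\sum_(v | [&& v \in T, P v, (0 < m (rk v))%N & clear v m]) p@_m).
  rewrite (bigID (fun v => (0 < m (rk v))%N && clear v m)) /=.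
  rewrite [X in _ + X]big1 ?addr0 => [|v]; last first.
    case/andP=> _; rewrite mcoeffXM negb_and; case: (posnP (m (rk v))) => //= m_v.
    rewrite mcoeff_extract => ncl; case: ifP => // /clearP cl.
    case/negP: ncl; apply/clearP => w wT lt_vw.
    have := cl w wT lt_vw; rewrite mnmBE mnm1E (inj_eq enum_rank_inj).
    by case: (eqVneq v w) lt_vw => [->|_] /=; rewrite ?ltnn ?subn0.
  apply: eq_big => [v|v]; first by rewrite !andbA.
  case/andP=> _ /andP[m_v cl]; rewrite mcoeffXM m_v mcoeff_extract.
  have le_vm : (U_(rk v) <= m)%MM by rewrite lep1mP -lt0n.
  rewrite submK //; case: ifP => // /negP[]; apply/clearP => w wT lt_vw.
  by have /clearP/(_ w wT lt_vw) m_w := cl; rewrite mnmBE m_w sub0n.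
case: ifPn => [/forall_inP zm | /forall_inPn[w0 w0T]].
  rewrite subrr big1 // => v /and4P[vT Pv + _].
  by have := zm v vT; rewrite Pv => /eqP ->.
rewrite negb_imply -lt0n subr0 => /andP[Pw0 m_w0].
pose Q v := [&& v \in T, P v & (0 < m (rk v))%N].
have Qw0 : Q w0 by rewrite /Q w0T Pw0.
case: (arg_maxnP (fun v => rk v : nat) Qw0) => t /and3P[tT Pt m_t] max_t.
rewrite (big_pred1 t) // => v /=; apply/and4P/eqP => [[vT Pv m_v cl]|->].
  have le_vt : (rk v <= rk t)%N by apply: max_t; rewrite /Q vT Pv m_v.
  apply/enum_rank_inj/val_inj/eqP; rewrite eqn_leq le_vt /= leqNgt.
  by apply/negP => lt_vt; move/clearP: cl => /(_ t tT lt_vt) m_t0; rewrite m_t0 in m_t.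
split=> //; apply/clearP => w wT lt_tw; apply/eqP; rewrite -leqn0 leqNgt.
apply/negP => m_w; have := lt_tw; rewrite ltnNge => /negP[]; apply: max_t.
by rewrite /Q wT m_w (P_up t w).
Qed.

Definition top_var A : option V :=
  [pick t in A :&: T | [forall w in A :&: T, (rk w <= rk t)%N]].

Lemma top_var_some A t : t \in A -> t \in T ->
  {in A, forall w, w \in T -> (rk w <= rk t)%N} -> top_var A = Some t.
Proof.
move=> tA tT max_t; rewrite /top_var; case: pickP => [t' /=|/(_ t)] /=.
  rewrite inE => /andP[/andP[tA' tT'] /forall_inP max_t'].
  congr Some; apply/enum_rank_inj/val_inj/eqP; rewrite eqn_leq.
  by rewrite max_t //= max_t' // inE tA.
rewrite inE tA tT /= => /negbT/forall_inPn[w]; rewrite inE => /andP[wA wT].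
by rewrite max_t.
Qed.

Variant top_var_spec A : option V -> Prop :=
| TopVarSome t of t \in A & t \in T & {in A, forall w, w \in T -> (rk w <= rk t)%N} :
    top_var_spec A (Some t)
| TopVarNone of {in A, forall w, w \notin T} : top_var_spec A None.

Lemma top_varP A : top_var_spec A (top_var A).
Proof.
case: (set_0Vmem (A :&: T)) => [eq0 | [w0 w0AT]].
  have noA : {in A, forall w, w \notin T}.
    move=> w wA; apply/negP => wT; have := in_set0 w.
    by rewrite -eq0 inE wA wT.
  rewrite /top_var; case: pickP => [t|_]; last by constructor.
  by rewrite eq0 inE.
case: (arg_maxnP (fun v => rk v : nat) w0AT) => t /setIP[tA tT] max_t.
have max_t' : {in A, forall w, w \in T -> (rk w <= rk t)%N}.
  by move=> w wA wT; apply/max_t/setIP.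
by rewrite (top_var_some tA tT max_t'); constructor.
Qed.

(** The contracting homotopy: moves the largest [T]-variable of a monomial into the
exterior part whenever it exceeds all vertices of [T] already there. *)
Definition contraction (c : {set V} -> R) A : R :=
  if top_var A is Some t then (-1) ^+ sgn_exp t A * cut t (c (A :\ t)) else 0.

Lemma sgn_expD1 v w A :
  w \in A -> sgn_exp v A = ((rk v < rk w)%N + sgn_exp v (A :\ w))%N.
Proof. by move=> wA; rewrite -{1}(setD1K wA) sgn_expU1 // !inE eqxx. Qed.

(** On a term m e_A compare the largest [T]-variable [t] of [A] with that of [m]:
the terms that move the larger one back and forth give the identity, all others
cancel in pairs. What is left over is free of [T] altogether. *)
Lemma koszul_homotopy (c : {set V} -> R) A :
  koszulR T (contraction c) A + contraction (koszulR T c) A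
    = c A - (if [disjoint A & T]
             then extract (fun m => [forall w in T, m (rk w) == 0%N]) 0%MM (c A)
             else 0).
Proof.
rewrite {2}/contraction; case: top_varP => [t tA tT max_t | noA]; last first.
  have -> : [disjoint A & T] by apply/pred0P => w /=; apply/negP => /andP[/noA /negP].
  rewrite addr0; have <- := @sum_cut predT (c A) (fun _ _ _ _ _ _ => isT).
  rewrite koszulRE; apply: eq_big => [v|v /andP[vT vA]].
    case vT: (v \in T) => //=; apply: contraTT vT => /negPn; exact: noA.
  have kt : top_var (v |: A) = Some v.
    apply: top_var_some => //; first exact: setU11.
    by move=> w /setU1P[->//|/noA/negP].
  by rewrite /contraction kt setU1K // sgn_expU1 // ltnn add0n mulrCA signrMK.
have -> : [disjoint A & T] = false.
  by apply/negP => /pred0P/(_ t) /=; rewrite tA tT.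
rewrite subr0 !koszulRE (bigID (fun v => (rk t < rk v)%N)) /=.
set S1 := \sum_(i | _) _; set S2 := \sum_(i | _) _.
(* [S1] adjoins a vertex above [t], [S2] one below it. *)
have ES1 : S1 = \sum_(v in T | (rk t < rk v)%N) var k v * cut v (c A).
  rewrite /S1; apply: eq_big => [v|v].
    case: (ltnP (rk t) (rk v)) => lt_tv; rewrite ?andbF //= andbT.
    case vT: (v \in T) => //=; apply: contraTN lt_tv => vA.
    by rewrite -leqNgt max_t.
  case/andP=> /andP[vT vA] lt_tv.
  have kt : top_var (v |: A) = Some v.
    apply: top_var_some => //; first exact: setU11.
    move=> w /setU1P[->//|wA wT]; apply: leq_trans (max_t w wA wT) _; exact: ltnW.
  by rewrite /contraction kt setU1K // sgn_expU1 // ltnn add0n mulrCA signrMK.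
have tAt : t \notin A :\ t by rewrite !inE eqxx.
rewrite (bigD1 t) /=; last by rewrite tT.
rewrite setD1K // [cut t _]extractD mulrDr [extract _ _ (\sum_(_ | _) _)]extract_sum.
rewrite extract_sign [extract _ _ _]cut_varE.
rewrite {1}(sgn_expD1 t tA) ltnn add0n signrMK.
set S3 := \sum_(i | _) _.
have ES3 : (-1) ^+ sgn_exp t A * S3 = - S2.
  rewrite /S3 /S2 mulr_sumr -sumrN.
  rewrite [LHS](bigID (fun v => (rk t < rk v)%N)) /= big1 ?add0r => [|v]; last first.
    case/andP=> /andP[/andP[vT _] _] lt_tv.
    by rewrite extract_sign [extract _ _ _]cut_var_above // !mulr0.
  apply: eq_big => [v|v].
    rewrite !inE negb_and negbK; case vT: (v \in T) => //=.
    by case: (eqVneq v t) => [->|] /=; rewrite ?tA ?andbT //= andbF.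
  case/andP=> /andP[/andP[vT vAt] neq_vt] nlt_tv.
  have vA : v \notin A by move: vAt; rewrite !inE (negbTE neq_vt).
  have lt_vt : (rk v < rk t)%N.
    rewrite ltn_neqAle leqNgt nlt_tv andbT (inj_eq val_inj) (inj_eq enum_rank_inj).
    by [].
  have kt : top_var (v |: A) = Some t.
    apply: top_var_some => //; first by rewrite inE tA orbT.
    by move=> w /setU1P[->|wA wT]; [move=> _; apply: ltnW | apply: max_t].
  rewrite extract_sign [extract _ _ _]cut_var_below //.
  rewrite /contraction kt sgn_expU1 // (ltnNge (rk t)) (ltnW lt_vt) add0n.
  have -> : (v |: A) :\ t = v |: A :\ t.
    by apply/setP => w; rewrite !inE; case: (eqVneq w v) => [->|] //=; rewrite neq_vt.
  rewrite (sgn_expD1 v tA) lt_vt exprS mulN1r !mulNr opprK.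
  by rewrite mulrCA; congr (_ * _); rewrite mulrCA.
rewrite ES3 addrACA subrr addr0 ES1 sum_cut; last first.
  by move=> u v _ _ lt_tu lt_uv; apply: ltn_trans lt_uv.
by rewrite addrNK.
Qed.

End Homotopy.

(** * Induced matchings *)

Section Matching.
Local Open Scope ring_scope.
Variables (V : finType) (H : sgraph V).
Implicit Types (M N : {set {set V}}).

Lemma induced_matchingP M :
  reflect ((forall e, e \in M -> exists u v, H u v /\ e = [set u; v]) /\
           (forall e f, e \in M -> f \in M -> e != f ->
              forall u v, u \in e -> v \in f -> u != v /\ ~~ H u v))
          (induced_matching H M).
Proof.
apply: (iffP andP) => -[edgeM indM]; split.
- by move=> e /(forall_inP edgeM) /existsP[u /existsP[v /andP[uv /eqP]]]; exists u, v.
- move=> e f eM fM nef u v ue vf.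
  have /andP[dis] := implyP (forall_inP (forall_inP indM e eM) f fM) nef.
  move/forall_inP/(_ u ue)/forall_inP/(_ v vf) => ->; split=> //.
  by apply: contraTneq ue => ->; rewrite (disjointFl dis vf).
- apply/forall_inP => e /edgeM[u [v [uv ->]]].
  by apply/existsP; exists u; apply/existsP; exists v; rewrite uv eqxx.
apply/forall_inP => e eM; apply/forall_inP => f fM; apply/implyP => nef.
have ind := indM e f eM fM nef; apply/andP; split.
  rewrite disjoints_subset; apply/subsetP => u ue; rewrite inE.
  by apply/negP => uf; have [] := ind u u ue uf; rewrite eqxx.
by apply/forall_inP => u ue; apply/forall_inP => v vf; have [] := ind u v ue vf.
Qed.

Lemma induced_matching_sub M N :
  N \subset M -> induced_matching H M -> induced_matching H N.
Proof.
move=> /subsetP NM /induced_matchingP[edgeM indM]; apply/induced_matchingP.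
by split=> [e /NM/edgeM // | e f /NM eM /NM fM]; apply: indM.
Qed.

Lemma induced_matchingU1 M u v :
    induced_matching H M -> H u v ->
    (forall e x, e \in M -> x \in e -> [&& x != u, x != v, ~~ H x u & ~~ H x v]) ->
  induced_matching H ([set u; v] |: M) /\ #|[set u; v] |: M| = #|M|.+1.
Proof.
move=> /induced_matchingP[edgeM indM] uv sep.
have newM : [set u; v] \notin M.
  by apply/negP => /sep/(_ (set21 u v)); rewrite eqxx.
have sep' e x y : e \in M -> x \in e -> y \in [set u; v] -> x != y /\ ~~ H x y.
  by move=> eM xe /set2P[] ->; have /and4P[] := sep e x eM xe.
split; last by rewrite cardsU1 newM.
apply/induced_matchingP; split=> [e /setU1P[->|/edgeM //] | e f].
  by exists u, v.
move=> /setU1P[->|eM] /setU1P[->|fM] nef x y xe yf.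
- by rewrite eqxx in nef.
- by have [] := sep' f y x fM yf xe; rewrite eq_sym adj_sym.
- exact: sep' eM xe yf.
- exact: indM eM fM nef x y xe yf.
Qed.

End Matching.

(** * Polynomials with constrained monomials *)

Section Support.
Local Open Scope ring_scope.
Variables (k : fieldType) (n : nat).
Implicit Types (p q : {mpoly k[n]}) (m : 'X_{1..n}) (Q : 'X_{1..n} -> Prop).

(** Both membership in a monomial ideal and homogeneity are conditions of this
form. *)
Definition supported Q p := forall m, p@_m != 0 -> Q m.

Lemma supported0 Q : supported Q 0.
Proof. by move=> m; rewrite mcoeff0 eqxx. Qed.

Lemma supportedD Q p q : supported Q p -> supported Q q -> supported Q (p + q).
Proof.
move=> Qp Qq m; rewrite mcoeffD; have [-> | /Qp //] := eqVneq p@_m 0.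
by rewrite add0r; apply: Qq.
Qed.

Lemma supportedN Q p : supported Q p -> supported Q (- p).
Proof. by move=> Qp m; rewrite mcoeffN oppr_eq0; apply: Qp. Qed.

Lemma supportedB Q p q : supported Q p -> supported Q q -> supported Q (p - q).
Proof. by move=> Qp Qq; apply: supportedD => //; apply: supportedN. Qed.

Lemma supported_sign Q j p : supported Q p -> supported Q ((-1) ^+ j * p).
Proof. by move=> Qp m; rewrite mcoeffMsign mulrI_eq0 ?signr_eq0 //;
    [apply: Qp|apply: lregX; apply: lregN; apply: lreg1]. Qed.

Lemma supported_sum Q (I : Type) (r : seq I) (P : pred I) (F : I -> {mpoly k[n]}) :
  (forall i, P i -> supported Q (F i)) -> supported Q (\sum_(i <- r | P i) F i).
Proof. by move=> QF; apply: big_ind => //; [apply: supported0 | apply: supportedD]. Qed.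

Lemma supportedX Q Q' (i : 'I_n) p :
  (forall m, Q m -> Q' (m + U_(i))%MM) -> supported Q p -> supported Q' ('X_i * p).
Proof.
move=> QQ' Qp m; rewrite mcoeffXM; case: ifP => [m_i|]; last by rewrite eqxx.
by move=> /Qp/QQ'; rewrite submK // lep1mP -lt0n.
Qed.

Lemma supported_extract Q Q' (C : pred 'X_{1..n}) u p :
  (forall m, C m -> Q (m + u)%MM -> Q' m) -> supported Q p ->
      supported Q' (extract C u p).
Proof.
move=> QQ' Qp m; rewrite mcoeff_extract; case: ifP => [Cm|]; last by rewrite eqxx.
by move=> /Qp; apply: QQ'.
Qed.

Lemma supportedM Q1 Q2 Q p q :
  (forall m1 m2, Q1 m1 -> Q2 m2 -> Q (m1 + m2)%MM) ->
  supported Q1 p -> supported Q2 q -> supported Q (p * q).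
Proof.
move=> QQ Qp Qq m; rewrite -mcoeff_msupp => /msuppM_le /allpairsP[[m1 m2] /= []].
by rewrite !mcoeff_msupp => /Qp Q1m /Qq Q2m ->; apply: QQ.
Qed.

End Support.

Section KoszulSupport.
Local Open Scope ring_scope.
Variables (k : fieldType) (V : finType).
Local Notation R := {mpoly k[#|V|]}.
Local Notation mon := 'X_{1..#|V|}.
Local Notation rk := (@enum_rank V).
Implicit Types (v w u : V) (A B T : {set V}) (p : R) (m : mon) (c b : {set V} -> R).

Lemma supported_koszulR T (Q Q' : {set V} -> mon -> Prop) c :
    (forall A v m, v \in T -> v \notin A -> Q (v |: A) m -> Q' A (m + U_(rk v))%MM) ->
  (forall A, supported (Q A) (c A)) -> forall A, supported (Q' A) (koszulR T c A).
Proof.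
move=> QQ' Qc A; rewrite koszulRE; apply: supported_sum => v /andP[vT vA].
by apply: supported_sign; apply: supportedX (Qc (v |: A)) => m; apply: QQ'.
Qed.

Lemma supported_contraction T (Q Q' : {set V} -> mon -> Prop) c :
    (forall A t m, t \in T -> t \in A -> Q (A :\ t) (m + U_(rk t))%MM -> Q' A m) ->
  (forall A, supported (Q A) (c A)) -> forall A, supported (Q' A) (contraction T c A).
Proof.
move=> QQ' Qc A; rewrite /contraction; case: top_varP => [t tA tT _|_];
    last exact: supported0.
by apply: supported_sign; apply: supported_extract (Qc (A :\ t)) => m _; apply: QQ'.
Qed.

Lemma koszulRB T c b A :
  koszulR T (fun B => c B - b B) A = koszulR T c A - koszulR T b A.
Proof. exact: (@koszulB k V R^o). Qed.

Lemma koszulRD T c b A :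
  koszulR T (fun B => c B + b B) A = koszulR T c A + koszulR T b A.
Proof. exact: (@koszulD k V R^o). Qed.

Lemma koszulRZ T p c A : koszulR T (fun B => p * c B) A = p * koszulR T c A.
Proof. exact: (@koszulZ k V R^o). Qed.

Lemma koszulR_koszulR T c A : koszulR T (koszulR T c) A = 0.
Proof. exact: (@koszul_koszul k V R^o). Qed.

Lemma eq_koszulR T c b A : c =1 b -> koszulR T c A = koszulR T b A.
Proof. exact: (@eq_koszul k V R^o). Qed.

Lemma koszulR_split T c A : koszulR [set: V] c A = koszulR T c A + koszulR (~: T) c A.
Proof.
rewrite !koszulRE (bigID (mem T)) /=; congr (_ + _); apply: eq_bigl => v.
  by rewrite inE andbC.
by rewrite !inE andbC.
Qed.

Lemma mon_neq0 m : (0 < mdeg m)%N -> exists v, (0 < m (rk v))%N.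
Proof.
rewrite mdegE lt0n sum_nat_eq0 => /forallPn[i]; rewrite /= -lt0n => m_i.
by exists (enum_val i); rewrite enum_valK.
Qed.

(** The contraction for all variables: only a constant at the empty set can
obstruct. *)
Lemma koszul_exact c :
    (forall A, koszulR [set: V] c A = 0) -> (c set0)@_0%MM = 0 ->
  forall A, c A = koszulR [set: V] (contraction [set: V] c) A.
Proof.
move=> Dc0 c0 A; have := koszul_homotopy [set: V] c A.
have -> : contraction [set: V] (koszulR [set: V] c) A = 0.
  by rewrite /contraction; case: top_varP => // t _ _ _;
      rewrite Dc0 [cut _ _ _]extract0 mulr0.
rewrite addr0 => ->; case: ifP => [A0|]; last by rewrite subr0.
have -> : A = set0.
  by apply/eqP; rewrite -subset0 -setCT -disjoints_subset.
rewrite [extract _ _ _](_ : _ = 0) ?subr0 //; apply/mpolyP => m.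
rewrite mcoeff_extract mcoeff0 addm0; case: ifP => // /forall_inP m0.
suff -> : m = 0%MM by [].
apply/mnmP => i; rewrite mnm0E; have := m0 (enum_val i) (in_setT _).
by rewrite enum_valK => /eqP.
Qed.

End KoszulSupport.

(** * Koszul homology above the matching number *)

Section Vanishing.
Local Open Scope ring_scope.
Variables (k : fieldType) (V : finType) (H : sgraph V).
Local Notation R := {mpoly k[#|V|]}.
Local Notation mon := 'X_{1..#|V|}.
Local Notation rk := (@enum_rank V).
Implicit Types (v w u : V) (A B T : {set V}) (p : R) (m : mon) (c b f : {set V} -> R).

(** The monomials of the ideal generated by all edges and by the variables outside
[T]; its quotient is the edge ring of the subgraph induced on [T], kept over the
same polynomial ring. *)
Definition killed T m : Prop :=
  (exists2 v, v \notin T & (0 < m (rk v))%N) \/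
  (exists u v, [/\ H u v, (0 < m (rk u))%N & (0 < m (rk v))%N]).

(** Koszul homology of the quotient by the ideal of [killed T] vanishes when the
polynomial degree of the coefficients, that is internal minus homological degree,
exceeds [r]; in other words the regularity is at most [r]. *)
Definition koszul_vanish T r : Prop := forall d c, (r <= d)%N ->
  (forall A, supported (fun m => mdeg m = d.+1) (c A)) ->
  (forall A, supported (killed T) (koszulR [set: V] c A)) ->
  exists2 b, (forall A, supported (fun m => mdeg m = d) (b A))
           & forall A, supported (killed T) (c A - koszulR [set: V] b A).

Lemma killedD T m m' : killed T m -> killed T (m + m')%MM.
Proof.
case=> [[v vT m_v] | [u [v [uv m_u m_v]]]]; [left; exists v | right; exists u, v] => //.
  by rewrite mnmDE ltn_addr.
by rewrite !mnmDE !ltn_addr.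
Qed.

(** The quotient is a polynomial ring on [T], and the contraction for the
variables of [T] works modulo the other ones. *)
Lemma koszul_vanish_noedge T : {in T &, forall u v, ~~ H u v} -> koszul_vanish T 0.
Proof.
move=> noE d c _ deg_c Dc.
have outT m : killed T m -> exists2 v, v \notin T & (0 < m (rk v))%N.
  case=> // -[u [v [uv m_u m_v]]].
  have [uT|uT] := boolP (u \in T); last by exists u.
  by exists v => //; apply: contraTN uv => vT; apply: noE.
have bad_out c' : forall A, supported (killed T) (koszulR (~: T) c' A).
  apply: (supported_koszulR (Q := fun _ _ => True) (Q' := fun _ => killed T)) =>
      // A v m.
  by rewrite inE => vT _ _; left; exists v; rewrite // mnmDE mnm1E eqxx addn1.
exists (contraction T c).
  apply: (supported_contraction (Q := fun _ m => mdeg m = d.+1) (Q' := fun _ m =>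
      mdeg m = d)) => //.
  by move=> A t m _ _; rewrite mdegD mdeg1 addn1 => -[].
move=> A; rewrite (koszulR_split T) opprD addrA; apply: supportedB; last exact: bad_out.
have [eps Eeps hom] : exists2 eps, eps = (if [disjoint A & T]
    then extract (fun m => [forall w in T, m (rk w) == 0%N]) 0%MM (c A) else 0)
  & koszulR T (contraction T c) A + contraction T (koszulR T c) A = c A - eps by
      eexists; [reflexivity | apply: koszul_homotopy].
rewrite -[c A](subrK eps) -hom -[_ + _ + eps]addrA addrAC subrr add0r.
apply: supportedD; last first.
  rewrite Eeps; case: ifP => // _; last exact: supported0.
  apply: (supported_extract (Q := fun m => mdeg m = d.+1)) => // m /forall_inP m_T.
  rewrite addm0 => deg_m; have [|v m_v] := @mon_neq0 V m; first by rewrite deg_m.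
  by left; exists v => //; apply: contraTN m_v => /m_T/eqP ->.
move: A {eps Eeps hom}; apply: (supported_contraction (Q := fun _ =>
    killed T) (Q' := fun _ => killed T)).
  move=> A t m tT _ /outT[v vT]; rewrite mnmDE mnm1E (inj_eq enum_rank_inj).
  have [tv|_] := eqVneq t v; first by rewrite -tv tT in vT.
  by rewrite addn0; left; exists v.
move=> A; have /(canRL (addrK _)) -> := esym (koszulR_split T c A).
by apply: supportedB; [apply: Dc | apply: bad_out].
Qed.

(** Multiplication by [w] identifies the quotient for [T] without the neighbours
of [w] with the kernel of the projection from the quotient for [T] to the one for
[T :\ w], up to a degree shift. *)
Lemma koszul_vanish_step T w r : w \in T ->
    koszul_vanish (T :\ w) r.+1 -> koszul_vanish (T :\: [set v | H w v]) r ->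
  koszul_vanish T r.+1.
Proof.
move=> wT van1 van2 [//|d] c lt_rd deg_c Dc.
have [|b deg_b] := van1 _ c lt_rd deg_c.
- move=> A m /Dc[[v vT m_v] | edge_m]; last by right.
  by left; exists v; rewrite // in_setD1 negb_and vT orbT.
pose p A : R := c A - koszulR [set: V] b A.
move=> bad_p; have {}bad_p A : supported (killed (T :\ w)) (p A) := bad_p A.
(* The remainder [p] lies in the ideal for [T :\ w], so it is a multiple of [w]
   modulo the ideal for [T]. *)
pose f A := extract predT U_(rk w) (p A); pose g A := p A - var k w * f A.
have bad_g A : supported (killed T) (g A).
  move=> m; rewrite mcoeffB mcoeffXM mcoeff_extract /=.
  case: posnP => [m_w | m_w]; last by rewrite submK ?subrr ?eqxx // lep1mP -lt0n.
  rewrite subr0 => /bad_p[[v + m_v] | edge_m]; last by right.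
  rewrite in_setD1 negb_and negbK => /orP[/eqP eq_vw | vT]; last by left; exists v.
  by rewrite eq_vw m_w in m_v.
have deg_p A : supported (fun m => mdeg m = d.+2) (p A).
  apply: supportedB; first exact: deg_c.
  apply: (supported_koszulR (Q := fun _ m => mdeg m = d.+1) (Q' := fun _ m =>
      mdeg m = d.+2)) => // B v m _ _.
  by rewrite mdegD mdeg1 addn1 => ->.
have [||b' deg_b'] := van2 d f lt_rd.
- move=> A; apply: supported_extract (deg_p A) => m _.
  by rewrite mdegD mdeg1 addn1 => -[].
- move=> A m.
  have bad_wDf : supported (killed T) (var k w * koszulR [set: V] f A).
    rewrite -koszulRZ (@eq_koszulR k V _ _ (fun B => p B - g B)) => [|B]; last first.
      by rewrite /g subKr.
    rewrite koszulRB koszulRB koszulR_koszulR subr0; apply: supportedB; first exact: Dc.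
    apply: (supported_koszulR (Q := fun _ => killed T) (Q' := fun _ =>
        killed T)) => // B v m' _ _; exact: killedD.
  have := bad_wDf (m + U_(rk w))%MM.
  rewrite mcoeffXM mnmDE mnm1E eqxx addn1 addmK => bad_m /bad_m.
  case=> [[v vT] | [u [v [uv]]]]; rewrite !mnmDE !mnm1E !(inj_eq enum_rank_inj) /=.
    have [wv|_] := eqVneq w v; first by rewrite -wv wT in vT.
    by rewrite addn0; left; exists v; rewrite // in_setD negb_and vT orbT.
  have [eq_wu|_] := eqVneq w u; have [eq_wv|_] := eqVneq w v.
  - by move: uv; rewrite -eq_wu -eq_wv adj_irrefl.
  - by rewrite addn0 => _ m_v; left; exists v; rewrite // !inE eq_wu uv.
  - by rewrite addn0 => m_u _; left; exists u; rewrite // !inE eq_wv adj_sym uv.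
  - by rewrite !addn0 => m_u m_v; right; exists u, v.
move=> bad_f; exists (fun A => b A + var k w * b' A) => A.
  apply: supportedD; first exact: deg_b.
  apply: supportedX (deg_b' A) => m; by rewrite mdegD mdeg1 addn1 => ->.
rewrite koszulRD koszulRZ.
have -> : c A - (koszulR [set: V] b A + var k w * koszulR [set: V] b' A)
          = g A + var k w * (f A - koszulR [set: V] b' A).
  by rewrite /g mulrBr addrA subrK /p opprD addrA.
apply: supportedD; first exact: bad_g.
apply: supportedX (bad_f A) => m.
case=> [[v vT m_v] | edge_m]; last by apply: killedD; right.
move: vT; rewrite !inE negb_and negbK => /orP[wv | vT]; last by apply: killedD;
    left; exists v.
right; exists w, v; rewrite !mnmDE !mnm1E eqxx addn1 ltn_addr //.
Qed.

(** Every induced matching of [T] that avoids the neighbours of [w] extends by the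
edge between [w] and [y]. *)
Definition peelable := forall T u0 v0, u0 \in T -> v0 \in T -> H u0 v0 ->
  exists w y, [/\ w \in T, y \in T, H w y &
    forall u v, u \in T -> v \in T -> H u v -> ~~ H w u -> ~~ H w v ->
      ~~ H u y && ~~ H v y].

(** Deleting [w] does not increase the matching number, deleting its neighbours
decreases it, so the two hypotheses of [koszul_vanish_step] hold by induction. *)
Theorem koszul_vanish_matching T r : peelable ->
    (forall M, induced_matching H M -> (forall e, e \in M -> e \subset T) ->
        (#|M| <= r)%N) ->
  koszul_vanish T r.
Proof.
move=> peelH; have [n] := ubnP #|T|; elim: n T r => // n IHn T r leTn matT.
have [/existsP[u0 /andP[u0T /existsP[v0 /andP[v0T uv0]]]] | noE] :=
  boolP [exists u in T, exists v in T, H u v]; last first.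
  move=> d c _; apply: koszul_vanish_noedge => // u v uT vT; apply: contraNN noE => uv.
  by apply/existsP; exists u; rewrite uT; apply/existsP; exists v; rewrite vT.
have [w [y [wT yT wy peel]]] := peelH T u0 v0 u0T v0T uv0.
have ind0 : induced_matching H set0.
  by apply/induced_matchingP; split=> [e|e f]; rewrite inE.
have small T' : T' \proper T -> (#|T'| < n)%N.
  by move/proper_card => ltT; apply: leq_trans ltT _; rewrite -ltnS.
case: r matT => [|r] matT.
  have [|ind1 card1] := induced_matchingU1 ind0 wy; first by move=> e x; rewrite inE.
  have /matT := ind1; rewrite card1 cards0 ltn0 => /(_ _)/negP[] //.
  move=> e /setU1P[->|]; last by rewrite inE.
  by apply/subsetP => x /set2P[] ->.
apply: (@koszul_vanish_step T w) => //; apply: IHn.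
- apply: small; exact: properD1.
- move=> M indM subM; apply: matT => // e /subM/subset_trans; apply; exact: subsetDl.
- apply: small; apply/properP; split; first exact: subsetDl.
  by exists y; rewrite // !inE wy.
- move=> M indM subM; rewrite -ltnS.
  have [|ind1 <-] := induced_matchingU1 indM wy; last first.
    apply: matT => // e /setU1P[->|/subM/subset_trans]; last by apply; apply: subsetDl.
    by apply/subsetP => x /set2P[] ->.
  move=> e x eM xe; have /induced_matchingP[edgeM _] := indM.
  have [u [v [uv def_e]]] := edgeM e eM; have /subsetP sub_e := subM e eM.
  have sub_x z : z \in e -> z \in T /\ ~~ H w z.
    by move/sub_e; rewrite !inE => /andP[].
  have [ue ve] : u \in e /\ v \in e by rewrite def_e set21 set22.
  have [uT wu] := sub_x u ue; have [vT wv] := sub_x v ve; have [xT wx] := sub_x x xe.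
  have /andP[uy vy] := peel u v uT vT uv wu wv.
  have [z xz wz] : exists2 z, H x z & ~~ H w z.
    by move: xe; rewrite def_e => /set2P[] ->; [exists v | exists u;
        rewrite // adj_sym].
  apply/and4P; split.
  - by apply: contraNneq wz => <-.
  - by apply: contraNneq wx => ->.
  - by rewrite adj_sym.
  - by move: xe; rewrite def_e => /set2P[] ->.
Qed.
End Vanishing.

(** * Homogeneous components *)

Section Grading.
Local Open Scope ring_scope.
Variables (k : fieldType) (n : nat).
Implicit Types (p q : {mpoly k[n]}) (m : 'X_{1..n}).

(** Written additively, so that no monomial qualifies when [e < s]. *)
Definition has_degree (e s : nat) m := (mdeg m + s)%N = e.

Definition degree_part e s p := extract (fun m => (mdeg m + s)%N == e) 0%MM p.

Lemma supported_degree_part e s p : supported (has_degree e s) (degree_part e s p).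
Proof. by move=> m; rewrite mcoeff_extract; case: ifP => [/eqP //|]; rewrite eqxx. Qed.

Lemma degree_part_id e s p : supported (has_degree e s) p -> degree_part e s p = p.
Proof.
move=> deg_p; apply/mpolyP => m; rewrite mcoeff_extract addm0.
by case: ifP => // /eqP deg_m; apply/esym/eqP/idPn => /deg_p.
Qed.

Lemma degree_partD e s p q :
  degree_part e s (p + q) = degree_part e s p + degree_part e s q.
Proof. exact: extractD. Qed.

Lemma degree_partM e s s' p q : supported (has_degree s s') q ->
  degree_part e s' (p * q) = degree_part e s p * q.
Proof.
move=> deg_q.
have off : degree_part e s' ((p - degree_part e s p) * q) = 0.
  apply/mpolyP => m; rewrite mcoeff_extract mcoeff0 addm0.
  case: ifP => // /eqP deg_m; apply/eqP/idPn => nz.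
  suff: (mdeg m + s')%N <> e by [].
  move: m nz {deg_m}.
  apply: (supportedM (Q1 := fun m => (mdeg m + s)%N <> e) (Q2 := has_degree s s')) =>
      //.
    by move=> m1 m2 ne eq; rewrite mdegD -addnA eq.
  move=> m1; rewrite mcoeffB mcoeff_extract addm0.
  by case: ifP => [_|/eqP //]; rewrite subrr eqxx.
rewrite -{1}[p](subrK (degree_part e s p)) mulrDl degree_partD off add0r
    degree_part_id //.
apply: (supportedM (Q1 := has_degree e s)) deg_q; last exact: supported_degree_part.
by rewrite /has_degree => m1 m2 <- <-; rewrite mdegD addnA.
Qed.

Definition homog_row e r (sh : 'I_r -> nat) (v : 'rV[{mpoly k[n]}]_r) :=
  forall b, supported (has_degree e (sh b)) (v 0 b).

Definition homog_mx r r' (sh : 'I_r -> nat) (sh' : 'I_r' -> nat)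
    (M : 'M[{mpoly k[n]}]_(r, r')) :=
  forall a b, supported (has_degree (sh a) (sh' b)) (M a b).

Definition degree_part_row e r (sh : 'I_r -> nat) (v : 'rV[{mpoly k[n]}]_r) :=
  \row_b degree_part e (sh b) (v 0 b).

Lemma homog_degree_part_row e r sh v : @homog_row e r sh (degree_part_row e sh v).
Proof. by move=> b; rewrite mxE; apply: supported_degree_part. Qed.

Lemma degree_part_row_id e r sh v : @homog_row e r sh v -> degree_part_row e sh v = v.
Proof. by move=> hv; apply/rowP => b; rewrite mxE degree_part_id. Qed.

Lemma degree_part_row_mulmx e r r' (sh : 'I_r -> nat) (sh' : 'I_r' -> nat) v M :
  homog_mx sh sh' M -> degree_part_row e sh' (v *m M) = degree_part_row e sh v *m M.
Proof.
move=> hM; apply/rowP => b; rewrite !mxE /degree_part extract_sum.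
by apply: eq_bigr => a _; rewrite mxE; apply: degree_partM.
Qed.

Lemma homog_row_mulmx e r r' (sh : 'I_r -> nat) (sh' : 'I_r' -> nat) v M :
  homog_mx sh sh' M -> homog_row e sh v -> homog_row e sh' (v *m M).
Proof.
move=> hM hv; rewrite -(degree_part_row_id hv) -(degree_part_row_mulmx e v hM);
    exact: homog_degree_part_row.
Qed.

End Grading.

(** * Betti numbers from Koszul homology *)

Section Zigzag.
Local Open Scope ring_scope.
Variables (k : fieldType) (V : finType).
Local Notation R := {mpoly k[#|V|]}.
Local Notation mon := 'X_{1..#|V|}.
Local Notation rk := (@enum_rank V).
Local Notation D := (koszul [set: V]).
Implicit Types (A B : {set V}).

(** An element of the [p]-th exterior power tensored with a free module with
generators in degrees [sh], of total degree [j]. *)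
Definition graded_family p j r (sh : 'I_r -> nat) (w : {set V} -> 'rV[R]_r) :=
  forall A b, supported (fun m => #|A| = p /\ (mdeg m + sh b + p)%N = j) (w A 0 b).

Lemma koszul_entry r (w : {set V} -> 'rV[R]_r) A b :
  D w A 0 b = koszulR [set: V] (fun B => w B 0 b) A.
Proof.
by rewrite /koszul summxE; apply: eq_bigr => v _; rewrite mxE.
Qed.

Lemma koszul_mulmx r r' (w : {set V} -> 'rV[R]_r) (M : 'M_(r, r')) A :
  D (fun B => w B *m M) A = D w A *m M.
Proof.
by rewrite mulmx_suml; apply: eq_bigr => v _; rewrite scalemxAl.
Qed.

Lemma graded_koszul p j r sh (w : {set V} -> 'rV[R]_r) :
  graded_family p.+1 j sh w -> graded_family p j sh (D w).
Proof.
move=> fw A b; rewrite koszul_entry.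
pose Q p (A : {set V}) (m : mon) := #|A| = p /\ (mdeg m + sh b + p)%N = j.
apply: (supported_koszulR (Q := Q p.+1) (Q' := Q p)) => [{}A v m _ vA|{}A];
    last exact: fw.
rewrite /Q cardsU1 vA add1n mdegD mdeg1 => -[[->] <-]; split=> //.
by rewrite addn1 !addSn addnS.
Qed.

Lemma graded_koszul0 j r sh (w : {set V} -> 'rV[R]_r) A :
  graded_family 0 j sh w -> D w A = 0.
Proof.
move=> fw; apply: big1 => v /andP[_ vA]; rewrite [w _](_ : _ = 0) ?scaler0 //.
apply/rowP => b; apply/mpolyP => m; rewrite mxE mcoeff0; apply/eqP.
by apply: contraT => /fw[/eqP]; rewrite cardsU1 vA.
Qed.

Lemma graded_mulmx p j r r' (sh : 'I_r -> nat) (sh' : 'I_r' -> nat) w M :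
  homog_mx sh sh' M -> graded_family p j sh w ->
      graded_family p j sh' (fun A => w A *m M).
Proof.
move=> hM fw A b; have [cA | nA] := eqVneq #|A| p; last first.
  rewrite [w A](_ : _ = 0) ?mul0mx ?mxE; first exact: supported0.
  apply/rowP => a; apply/mpolyP => m; rewrite mxE mcoeff0; apply/eqP.
  by apply: contraT => /fw[/eqP]; rewrite (negbTE nA).
have hM' : homog_mx (fun a => sh a + p)%N (fun b => sh' b + p)%N M.
  by move=> a b' m /hM; rewrite /has_degree addnA => ->.
have hw : homog_row j (fun a => sh a + p)%N (w A).
  by move=> a m /fw[_]; rewrite /has_degree addnA.
by move=> m /(homog_row_mulmx hM' hw); rewrite /has_degree addnA.
Qed.

(** The primitive comes from the contraction, so it inherits homogeneity in every
bidegree at once. *)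
Lemma koszul_exact_row r (w : {set V} -> 'rV[R]_r) :
    (forall A, D w A = 0) -> (forall b, (w set0 0 b)@_0%MM = 0) ->
  exists2 u, (forall A, w A = D u A)
    & forall p j sh, graded_family p j sh w -> graded_family p.+1 j sh u.
Proof.
move=> Dw w0; exists (fun A => \row_b contraction [set: V] (fun B => w B 0 b) A).
  move=> A; apply/rowP => b; rewrite koszul_entry.
  have Dwb B : koszulR [set: V] (fun B =>
      w B 0 b) B = 0 by rewrite -koszul_entry Dw mxE.
  by rewrite (koszul_exact Dwb (w0 b)); apply: eq_koszulR => B; rewrite mxE.
move=> p j sh fw A b; rewrite mxE.
pose Q p (A : {set V}) (m : mon) := #|A| = p /\ (mdeg m + sh b + p)%N = j.
apply: (supported_contraction (Q := Q p) (Q' := Q p.+1)) => [{}A t m _ tA|{}A];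
    last exact: fw.
rewrite /Q (cardsD1 t A) tA add1n mdegD mdeg1 => -[-> <-]; split=> //.
by rewrite addn1 !addSn addnS.
Qed.

Lemma koszul_const r (w : {set V} -> 'rV[R]_r) A b : (D w A 0 b)@_0%MM = 0.
Proof.
rewrite koszul_entry koszulRE raddf_sum big1 //= => v _.
by rewrite mcoeffMsign mcoeffXM mnm0E mulr0.
Qed.

Variables (I : R -> Prop) (F : min_resolution I).
Hypothesis I0 : I 0.
Hypothesis ID : forall p q, I p -> I q -> I (p + q).
Hypothesis IM : forall p q, I q -> I (p * q).
Hypothesis I_extract : forall Q p, I p -> I (extract Q 0%MM p).

Local Notation rank := (rank F).
Local Notation diff := (diff F).
Local Notation aug := (aug F).
Local Notation shift := (@shift _ _ _ F _).

Let IN p : I p -> I (- p).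
Proof. by move=> /(IM (-1)); rewrite mulN1r. Qed.

Let IB p q : I p -> I q -> I (p - q).
Proof. by move=> Ip Iq; apply: ID => //; apply: IN. Qed.

Let I_koszulR T c A : (forall B, I (c B)) -> I (koszulR T c A).
Proof.
move=> Ic; rewrite koszulRE; apply: big_ind => // v _.
by apply: IM; apply: IM.
Qed.

(** The kernel of F_q -> F_(q-1), where F_(-1) is R/I. *)
Definition is_cycle q : 'rV[R]_(rank q) -> Prop :=
  match q with
  | 0 => fun v => I ((v *m aug) 0 0)
  | q'.+1 => fun v => v *m diff q' = 0
  end.

Lemma is_cycleP q v : is_cycle v <-> exists w, v = w *m diff q.
Proof. by case: q v => [|q] v; [apply: exact_aug | apply: exact_diff]. Qed.

Lemma is_cycle_diff q (w : 'rV_(rank q.+1)) : is_cycle (w *m diff q).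
Proof. by apply/is_cycleP; exists w. Qed.

Lemma homog_diff q : homog_mx (fun a => shift a) (fun b => shift b) (diff q).
Proof.
move=> a b; have := diff_homog a b; case: ifP => [le_s | _ /eqP ->];
    last exact: supported0.
move=> /dhomogP hom m; rewrite -mcoeff_msupp => /hom hom_m.
by rewrite /has_degree [mdeg m]hom_m subnK.
Qed.

Lemma homog_aug : homog_mx (fun a => shift a) (fun _ : 'I_1 => 0%N) aug.
Proof.
move=> a b m; rewrite (ord1 b) -mcoeff_msupp.
by have /dhomogP hom := aug_homog a; move=> /hom hom_m; rewrite /has_degree addn0.
Qed.

Lemma diff_const q (v : 'rV_(rank q.+1)) b : ((v *m diff q) 0 b)@_0%MM = 0.
Proof.
rewrite mxE raddf_sum big1 //= => a _.
by rewrite rmorphM /= (diff_min a b) mulr0.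
Qed.

(** Any preimage can be replaced by its component of the right degree, since the
differential is homogeneous. *)
Lemma graded_lift p j q (w : {set V} -> 'rV_(rank q)) :
    graded_family p j (fun a => shift a) w -> (forall A, is_cycle (w A)) ->
  exists2 w', graded_family p j (fun a => shift a) w' & forall A, w A = w' A *m diff q.
Proof.
move=> fw bw; have [w' def_w] := fin_all_exists (fun A => (is_cycleP (w A)).1 (bw A)).
pose sp q' (a : 'I_(rank q')) := (shift a + p)%N.
exists (fun A => if #|A| == p then degree_part_row j (@sp _) (w' A) else 0).
  move=> A b m; case: (#|A| =P _) => [cA | _]; last by rewrite mxE mcoeff0 eqxx.
  by move/homog_degree_part_row; rewrite /has_degree addnA.
move=> A; case: (#|A| =P _) => [cA | nA].
  have hM : homog_mx (@sp q.+1) (@sp q) (diff q).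
    by move=> a b m /homog_diff; rewrite /has_degree addnA => ->.
  rewrite -(degree_part_row_mulmx j _ hM) -def_w degree_part_row_id // => a m /fw[_].
  by rewrite /has_degree addnA.
rewrite mul0mx; apply/rowP => b; apply/mpolyP => m; rewrite mxE mcoeff0; apply/eqP.
by apply: contraT => /fw[/eqP]; move/eqP: nA => /negbTE ->.
Qed.

(** The Koszul differential of [w] is a cycle of the resolution, so it lifts to a
family [w'] one step further along F and one step lower in the exterior power, of
the same kind. By induction [w'] is a sum of boundaries in both directions;
subtracting the corresponding correction from [w] leaves a Koszul cycle, which is
a boundary. At [p = 0] the absence of generators of degree [j] forces the
coefficients of [w] into the ideal of the variables. *)
Lemma zigzag_down i j : (forall a : 'I_(rank i), shift a != j) ->
  forall p q (w : {set V} -> 'rV_(rank q)), (p + q)%N = i ->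
    graded_family p j (fun a => shift a) w -> (forall A, is_cycle (D w A)) ->
  exists b b', forall A, w A = D b A + b' A *m diff q.
Proof.
move=> no_j; elim=> [|p IHp] q w def_i fw bw.
  rewrite add0n in def_i; rewrite -def_i in no_j.
  have [||u def_w _] := @koszul_exact_row _ w.
  - by move=> A; apply: graded_koszul0 fw.
  - move=> b; apply/eqP; apply: contraT => /fw[_].
    by rewrite mdeg0 add0n addn0 => /eqP; rewrite (negbTE (no_j b)).
  by exists u, (fun _ => 0) => A; rewrite mul0mx addr0.
have [w' fw' def_Dw] := graded_lift (graded_koszul fw) bw.
have [||| b [b' def_w']] := IHp q.+1 w'.
- by rewrite addnS -addSn.
- exact: fw'.
- by move=> A /=; rewrite -koszul_mulmx -(eq_koszul _ _ def_Dw) koszul_koszul.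
have Dwb A : D (fun B => w B - b B *m diff q) A = 0.
  rewrite koszulB koszul_mulmx def_Dw def_w' mulmxDl addrAC subrr add0r.
  exact: (is_cycle_diff (b' A)).
have [|u def_wb _] := koszul_exact_row Dwb.
  move=> c; rewrite mxE mcoeffD mxE mcoeffN diff_const subr0; apply/eqP.
  by apply: contraT => /fw[]; rewrite cards0.
by exists u, b => A; rewrite -def_wb subrK.
Qed.

Lemma betti_neq0 i j :
  reflect (exists a : 'I_(rank i), shift a = j) (betti F i j != 0%N).
Proof.
rewrite -lt0n card_gt0; apply: (iffP (set0Pn _)) => -[a].
  by rewrite inE => /eqP; exists a.
by move=> eq_j; exists a; rewrite inE eq_j.
Qed.

(** Lift [z] to F_0 and chase it along the resolution. *)
Theorem betti_of_koszul i j (z : {set V} -> R) :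
    (forall A, supported (fun m => #|A| = i /\ (mdeg m + i)%N = j) (z A)) ->
    (forall A, I (koszulR [set: V] z A)) ->
    ~ (exists b, forall A, I (z A - koszulR [set: V] b A)) ->
  betti F i j != 0%N.
Proof.
move=> deg_z Iz nbz; apply: contraT; rewrite negbK => /eqP betti0.
have no_j (a : 'I_(rank i)) : shift a != j.
  by apply/eqP => eq_j; have /eqP := betti0; apply/negP/betti_neq0; exists a.
have [w0 def_z] := fin_all_exists (fun A => aug_surj F (z A)).
pose w A := if #|A| == i then degree_part_row j (fun a => shift a + i)%N (w0 A) else 0.
have fw : graded_family i j (fun a => shift a) w.
  move=> A a m; rewrite /w; case: (#|A| =P _) => [cA | _];
      last by rewrite mxE mcoeff0 eqxx.
  by move/homog_degree_part_row; rewrite /has_degree addnA.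
have Izw A : I (z A - (w A *m aug) 0 0).
  rewrite /w; case: (#|A| =P _) => [cA | nA]; last first.
    rewrite mul0mx mxE subr0 [z A](_ : _ = 0) //; apply/mpolyP => m.
    by rewrite mcoeff0; apply/eqP; apply: contraT => /deg_z[].
  have hM : homog_mx (fun a : 'I_(rank 0) => shift a + i)%N (fun _ : 'I_1 => i) aug.
    by move=> a b m /homog_aug; rewrite /has_degree addn0 => ->.
  rewrite -(degree_part_row_mulmx j _ hM) mxE.
  rewrite -(@degree_part_id _ _ j i (z A)) => [|m /deg_z[] //].
  by have /(I_extract (fun m => (mdeg m + i)%N == j)) := def_z A; rewrite extractB.
have Ikw A : I ((D w A *m aug) 0 0).
  have -> : (D w A *m aug) 0 0 = koszulR [set: V] (fun B => (w B *m aug) 0 0) A.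
    by rewrite -koszul_mulmx koszul_entry.
  rewrite -[koszulR _ _ _](subKr (koszulR [set: V] z A)); apply: IB => //.
  by rewrite -koszulRB; apply: I_koszulR.
have [b [b' def_w]] := @zigzag_down i j no_j i 0 w (addn0 i) fw Ikw.
case: nbz; exists (fun B => (b B *m aug) 0 0) => A.
rewrite -[z A](subrK ((w A *m aug) 0 0)) -addrA; apply: ID => //.
rewrite def_w mulmxDl mxE -koszul_mulmx koszul_entry addrAC subrr add0r.
exact: (is_cycle_diff (b' A)).
Qed.

(** What a family in F_q inherits in the chase opposite to [zigzag_down]: its
image in F_(q-1) is a Koszul boundary. For [q = 0] its image in R/I is a Koszul
cycle. *)
Definition boundary_lifts p j q : ({set V} -> 'rV[R]_(rank q)) -> Prop :=
  match q with
  | 0 => fun w => forall A, I ((D w A *m aug) 0 0)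
  | q'.+1 => fun w => exists2 u, graded_family p.+1 j (fun a => shift a) u
                    & forall A, w A *m diff q' = D u A
  end.

(** The chase of [zigzag_down] read backwards: a Koszul primitive [u] of the image
of [w] satisfies the hypothesis one step closer to R/I, and a decomposition of [u]
corrects [w] to a cycle of the resolution. *)
Lemma zigzag_up i j :
    (forall z : {set V} -> R,
       (forall A, supported (fun m => #|A| = i /\ (mdeg m + i)%N = j) (z A)) ->
       (forall A, I (koszulR [set: V] z A)) ->
     exists b, forall A, I (z A - koszulR [set: V] b A)) ->
  forall q p (w : {set V} -> 'rV_(rank q)), (p + q)%N = i ->
    graded_family p j (fun a => shift a) w -> boundary_lifts p j w ->
  exists b b', forall A, w A = D b A + b' A *m diff q.
Proof.
move=> van; elim=> [|q IHq] p w def_i fw pre_w.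
  rewrite addn0 in def_i; subst p.
  pose z A := (w A *m aug) 0 0.
  have [||b Ib] := van z.
  - move=> A m nz_m; have := graded_mulmx homog_aug fw nz_m.
    by rewrite addn0.
  - move=> A; rewrite /z -koszul_entry koszul_mulmx; exact: pre_w.
  have [b0 def_b] := fin_all_exists (fun A => aug_surj F (b A)).
  have bw A : is_cycle (w A - D b0 A).
    rewrite /= mulmxBl mxE [X in _ + X]mxE -koszul_mulmx koszul_entry.
    rewrite -/(z A) -[z A](subrK (koszulR [set: V] b A)) -addrA; apply: ID => //.
    by rewrite -koszulRB; apply: I_koszulR.
  have [b' def_w] := fin_all_exists (fun A => (is_cycleP _).1 (bw A)).
  by exists b0, b' => A; rewrite -def_w addrCA subrr addr0.
have [u fu def_u] := pre_w.
have pre_u : boundary_lifts p.+1 j u.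
  case: q u fu w fw def_i pre_w def_u {IHq} => [|q] u fu w fw def_i _ def_u.
    by move=> A; rewrite -def_u; apply: (is_cycle_diff (q := 0)).
  have [||u' def_u' fu'] := @koszul_exact_row _ (fun A => u A *m diff q).
  - by move=> A; rewrite koszul_mulmx -def_u; apply: (is_cycle_diff (q := q.+1)).
  - by move=> b; apply: diff_const.
  by exists u' => //; apply: fu'; apply: graded_mulmx fu; apply: homog_diff.
have [||//|a [a' def_ua]] := IHq p.+1 u.
- by rewrite -def_i addnS.
- exact: fu.
have bw A : is_cycle (w A - D a' A).
  rewrite /= mulmxBl def_u -koszul_mulmx -koszulB.
  rewrite (@eq_koszul _ _ _ _ _ (D a)) ?koszul_koszul // => B.
  by rewrite def_ua addrK.
have [b' def_w] := fin_all_exists (fun A => (is_cycleP _).1 (bw A)).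
by exists a', b' => A; rewrite -def_w addrCA subrr addr0.
Qed.

(** A generator of degree [j] is a family at the empty set. By minimality its
differential has coefficients without constant term, hence is a Koszul boundary;
if the chase succeeds, the generator itself has no constant coefficient, which is
absurd. *)
Theorem betti_eq0_of_koszul i j :
    (forall z : {set V} -> R,
       (forall A, supported (fun m => #|A| = i /\ (mdeg m + i)%N = j) (z A)) ->
       (forall A, I (koszulR [set: V] z A)) ->
     exists b, forall A, I (z A - koszulR [set: V] b A)) ->
  betti F i j = 0%N.
Proof.
move=> van; apply/eqP; apply: contraT => /betti_neq0[e def_j].
pose w A : 'rV[R]_(rank i) := if A == set0 then delta_mx 0 e else 0.
have fw : graded_family 0 j (fun a => shift a) w.
  move=> A b m; rewrite /w; have [->|_] := eqVneq A set0;
      last by rewrite mxE mcoeff0 eqxx.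
  rewrite mxE /= cards0; have [->|_] := eqVneq b e; last by rewrite mcoeff0 eqxx.
  by rewrite mcoeff1; have [->|_] := eqVneq m 0%MM; rewrite ?eqxx // mdeg0 add0n addn0.
have pre_w : boundary_lifts 0 j w.
  case: (i) e @w fw {def_j} => [|i'] e w fw.
    by move=> A; rewrite (graded_koszul0 _ fw) mul0mx mxE.
  have [||u def_u fu] := @koszul_exact_row _ (fun A => w A *m diff i').
  - by move=> A; rewrite koszul_mulmx (graded_koszul0 _ fw) mul0mx.
  - by move=> b; apply: diff_const.
  by exists u => //; apply: fu; apply: graded_mulmx fw; apply: homog_diff.
have [b [b' def_w]] := @zigzag_up i j van i 0 w (add0n i) fw pre_w.
have := congr1 (fun v : 'rV_(rank i) => (v 0 e)@_0%MM) (def_w set0).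
rewrite mxE mcoeffD koszul_const diff_const addr0 /w eqxx mxE !eqxx mcoeff1 eqxx.
by move/eqP; rewrite oner_eq0.
Qed.

End Zigzag.

(** * Edge ideals as monomial ideals *)

Section EdgeIdeal.
Local Open Scope ring_scope.
Variables (k : fieldType) (V : finType) (H : sgraph V).
Local Notation R := {mpoly k[#|V|]}.
Local Notation mon := 'X_{1..#|V|}.
Local Notation rk := (@enum_rank V).

(** Membership becomes a condition on single monomials; in particular the edge
ideal is stable under taking homogeneous parts. *)
Lemma edge_idealP (p : R) : edge_ideal H p <-> supported (killed H [set: V]) p.
Proof.
split=> [[c ->] | bad_p].
  apply: supported_sum => u _; apply: supported_sum => v uv.
  apply: (supportedM (Q1 := fun _ => True) (Q2 := killed H [set: V])) => //.
    by move=> m1 m2 _; rewrite addmC; apply: killedD.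
  apply: (supportedX (Q := fun m => (0 < m (rk v))%N)) => [m m_v|].
    by right; exists u, v; rewrite !mnmDE mnm1E eqxx addn1 ltn_addr.
  rewrite -['X_(rk v)]mulr1; apply: (supportedX (Q := fun _ => True)) => // m _.
  by rewrite mnmDE mnm1E eqxx addn1.
have EI0 : edge_ideal H (0 : R).
  exists (fun _ _ => 0); rewrite big1 // => u _; rewrite big1 // => v _.
  by rewrite mul0r.
have EID (q r : R) : edge_ideal H q -> edge_ideal H r -> edge_ideal H (q + r).
  case=> [c ->] [d ->]; exists (fun u v => c u v + d u v).
  rewrite -big_split; apply: eq_bigr => u _; rewrite -big_split.
  by apply: eq_bigr => v _; rewrite mulrDl.
rewrite [p]mpolyE big_seq; apply: big_ind => // m.
rewrite mcoeff_msupp => /bad_p[[v] | [u [v [uv m_u m_v]]]]; first by rewrite inE.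
have le_m : (U_(rk u) + U_(rk v) <= m)%MM.
  apply/mnm_lepP => i; rewrite mnmDE !mnm1E.
  have [eq_u|_] := eqVneq (rk u) i; have [eq_v|_] := eqVneq (rk v) i => //=.
  - by move: uv; rewrite (enum_rank_inj (etrans eq_u (esym eq_v))) adj_irrefl.
  - by rewrite -eq_u.
  - by rewrite -eq_v.
pose q : R := p@_m *: 'X_[m - (U_(rk u) + U_(rk v))].
exists (fun u' v' => if (u' == u) && (v' == v) then q else 0).
rewrite (bigD1 u) //= (bigD1 v) //= !eqxx /= big1 ?addr0 => [|v']; last first.
  by case/andP=> _ /negbTE ->; rewrite mul0r.
rewrite big1 ?addr0 => [|u' /negbTE ->]; last by rewrite big1 // => v' _; rewrite mul0r.
by rewrite /q -scalerAl -!mpolyXD submK.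
Qed.

End EdgeIdeal.

(** * A Koszul cycle from a partition into complete bipartite blocks *)

Section BlockCycle.
Local Open Scope ring_scope.
Variables (k : fieldType) (V : finType) (H : sgraph V).
Local Notation R := {mpoly k[#|V|]}.
Local Notation mon := 'X_{1..#|V|}.
Local Notation rk := (@enum_rank V).
Local Notation D := (@koszulR k V [set: V]).
Implicit Types (A B G T : {set V}) (v w x y : V) (c b : {set V} -> R).

Definition set_mon T : mon := [multinom (enum_val i \in T : nat) | i < #|V|].

Lemma set_monE T v : set_mon T (rk v) = (v \in T).
Proof. by rewrite mnmE enum_rankK. Qed.

Lemma set_monU1 v T : v \notin T -> set_mon (v |: T) = (set_mon T + U_(rk v))%MM.
Proof.
move=> vT; apply/mnmP => i; rewrite -(enum_valK i) mnmDE !set_monE mnm1E.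
rewrite (inj_eq enum_rank_inj) !inE (eq_sym v).
by have [->|_] := eqVneq (enum_val i) v; rewrite ?(negbTE vT) ?addn0.
Qed.

Lemma mdeg_set_mon T : mdeg (set_mon T) = #|T|.
Proof.
rewrite mdegE (reindex rk) /=; last by apply: onW_bij; apply: enum_rank_bij.
rewrite -[RHS]sum1_card [RHS]big_mkcond /=; apply: eq_bigr => v _.
by rewrite set_monE; case: (v \in T).
Qed.

Lemma sgn_expE v A : sgn_exp v A = (\sum_(w in A) (rk v < rk w)%N)%N.
Proof.
rewrite /sgn_exp -[LHS]sum1_card [LHS]big_mkcond [RHS]big_mkcond /=.
by apply: eq_bigr => w _; rewrite inE; case: (w \in A); case: (_ < _)%N.
Qed.

Lemma sgn_expD v A B :
  B \subset A -> sgn_exp v A = (sgn_exp v (A :\: B) + sgn_exp v B)%N.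
Proof.
by move=> BA; rewrite !sgn_expE addnC (big_setID B) (setIidPr BA).
Qed.

Variables (sig X : {set V}) (bl : V -> nat) (n : nat) (al be : nat -> V).
Hypothesis bl_lt : {in sig, forall v, (bl v < n)%N}.
Hypothesis alP : forall t, (t < n)%N -> [/\ al t \in sig, al t \in X & bl (al t) = t].
Hypothesis beP : forall t, (t < n)%N -> [/\ be t \in sig, be t \notin X
    & bl (be t) = t].
Hypothesis joined : {in sig &, forall x y,
  x \in X -> y \notin X -> bl x = bl y -> H x y}.
Let cross := [set v in sig | (v == al (bl v)) || (v == be (bl v))].
Hypothesis apart : {in cross &, forall v w, bl v != bl w -> ~~ H v w}.

(** As the blocks of [sig] are numbered below [n], such a subset of [sig] meets
every block exactly once. *)
Definition transversal T :=
  [&& #|T| == n & [forall v in T, forall w in T, (bl v == bl w) ==> (v == w)]].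

Lemma transP T : reflect (#|T| = n /\ {in T &, injective bl}) (transversal T).
Proof.
apply: (iffP andP) => [[/eqP cT injT]|[cT injT]]; split=> //.
- move=> v w vT wT /eqP eq_bl; apply/eqP.
  by have /forall_inP/(_ w wT)/implyP := forall_inP injT v vT; apply.
- exact/eqP.
apply/forall_inP => v vT; apply/forall_inP => w wT; apply/implyP => /eqP eq_bl.
by apply/eqP/injT.
Qed.

Lemma trans_onto T t : T \subset sig -> transversal T -> (t < n)%N ->
  exists2 v, v \in T & bl v = t.
Proof.
move=> /subsetP subT /transP[cT injT] lt_t.
pose f v : 'I_n.-1.+1 := inord (bl v).
have n_gt0 : n = n.-1.+1 by rewrite prednK // (leq_trans _ lt_t).
have fE v : v \in T -> f v = bl v :> nat.
  by move=> vT; rewrite inordK // -n_gt0 bl_lt // subT.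
have injf : {in T &, injective f}.
  by move=> v w vT wT eq_f; apply: injT => //; rewrite -!fE // eq_f.
have : f @: T == setT by rewrite eqEcard subsetT cardsT card_ord card_in_imset // cT
    -n_gt0 leqnn.
move/eqP/setP/(_ (inord t)); rewrite in_setT => /imsetP[v vT /(congr1 val)].
by rewrite /= fE // inordK -?n_gt0 // => ->; exists v.
Qed.

Definition inversions T : nat :=
  \sum_(v in T) \sum_(w in T) ((rk v < rk w) && (bl w < bl v))%N.

(** For each [w] of [T] the pair formed with [x] counts one inversion exactly when
the two orders disagree; adding the comparison of ranks leaves, modulo two, the
comparison of blocks. *)
Lemma inversionsU1 x T : x \notin T -> {in T, forall w, bl w != bl x} ->
  (-1) ^+ (inversions (x |: T) + sgn_exp x T)
    = (-1) ^+ (inversions T + \sum_(w in T) (bl x < bl w)%N) :> k.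
Proof.
move=> xT nbl; rewrite -signr_odd -[RHS]signr_odd; congr (_ ^+ _).
pose f v w : nat := ((rk v < rk w) && (bl w < bl v))%N.
have -> : (inversions (x |: T) = inversions T + \sum_(w in T) (f x w + f w x))%N.
  rewrite /inversions (big_setU1 _ xT) /= (big_setU1 _ xT) /= ltnn add0n.
  under [X in (_ + X)%N]eq_bigr do rewrite (big_setU1 _ xT) /=.
  by rewrite big_split /= addnA addnC big_split.
rewrite sgn_expE -addnA !oddD -!oddD -big_split /= !oddD; congr (nat_of_bool (_ (+) _)).
rewrite (eq_bigr (fun w => ((bl x < bl w)%N : nat) + (((rk x < rk w) && (bl w < bl
    x))%N).*2)%N).
  by rewrite big_split /= oddD -(big_morph _ doubleD (erefl 0.*2)%N) odd_double addbF.
move=> w wT; have neq_xw : rk x != rk w :> nat.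
  by rewrite (inj_eq val_inj) (inj_eq enum_rank_inj); apply: contraNneq xT => ->.
have := nbl w wT; move: neq_xw; rewrite /f.
case: (ltngtP (rk x) (rk w)) => // _ _; case: (ltngtP (bl x) (bl w)) => //.
Qed.

(** The sign of sorting [T] by blocks, twisted by the positions of its vertices in
[sig]. *)
Definition orient T : k := (-1) ^+ (inversions T + \sum_(v in T) sgn_exp v sig).

(** The part of [orient (x |: T)] depending on [x] only through its block [t]. *)
Definition orient_above t T : k := (-1) ^+ (inversions T
  + \sum_(w in T) (t < bl w)%N + \sum_(v in T) sgn_exp v sig).

Lemma orientU1 x T : x \notin T -> {in T, forall w, bl w != bl x} ->
  orient (x |: T) = (-1) ^+ (sgn_exp x T + sgn_exp x sig) * orient_above (bl x) T.
Proof.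
move=> xT nbl; have Einv : (-1) ^+ inversions (x |: T)
    = (-1) ^+ sgn_exp x T * (-1) ^+ (inversions T + \sum_(w in T) (bl x < bl w)%N) :> k.
  by rewrite -(inversionsU1 xT nbl) exprD mulrC -mulrA -expr2 sqrr_sign mulr1.
rewrite /orient (big_setU1 _ xT) /= exprD Einv /orient_above !exprD.
by rewrite -!mulrA; congr (_ * _); rewrite [RHS]mulrCA; congr (_ * _); rewrite mulrCA.
Qed.

Lemma sqr_orient T : orient T * orient T = 1.
Proof. by rewrite -expr2 sqrr_sign. Qed.

Lemma trans_partner G v w : v \in G -> w \in G -> v != w -> bl v = bl w ->
  transversal (G :\ v) ->
  forall u, u \in G -> transversal (G :\ u) -> u = v \/ u = w.
Proof.
move=> vG wG neq_vw eq_bl _ u uG /transP[_ injG].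
have [->|neq_uv] := eqVneq u v; first by left.
have [->|neq_uw] := eqVneq u w; first by right.
case/eqP: neq_vw; apply: injG; rewrite // !inE eq_sym ?neq_uv ?neq_uw //.
Qed.

(** The sum, over the transversals contained in [X], of the signed wedge of their
complement in [sig] times their monomial. *)
Definition block_cycle A : R :=
  if [&& A \subset sig, sig :\: A \subset X & transversal (sig :\: A)]
  then (orient (sig :\: A)) *: 'X_[set_mon (sig :\: A)] else 0.

Lemma block_cycle_supp A m : (block_cycle A)@_m != 0 ->
  [/\ A \subset sig, sig :\: A \subset X, transversal (sig :\: A)
      & m = set_mon (sig :\: A)].
Proof.
rewrite /block_cycle; case: ifP => [/and3P[-> -> ->]|_]; last by rewrite mcoeff0 eqxx.
rewrite mcoeffZ mcoeffX; case: (set_mon _ =P m) => [->|] //.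
by rewrite mulr0 eqxx.
Qed.

Lemma block_cycle_coeff A :
  A \subset sig -> sig :\: A \subset X -> transversal (sig :\: A) ->
  (block_cycle A)@_(set_mon (sig :\: A)) = orient (sig :\: A).
Proof.
by move=> As AX tA; rewrite /block_cycle As AX tA mcoeffZ mcoeffX eqxx mulr1.
Qed.

Lemma block_cycle_deg A :
  supported (fun m => #|A| = (#|sig| - n)%N /\ (mdeg m + (#|sig| - n))%N = #|sig|)
      (block_cycle A).
Proof.
move=> m /block_cycle_supp[As _ /transP[cT _] ->]; rewrite mdeg_set_mon cT.
have := cardsD sig A; rewrite (setIidPr As) cT => def_n.
have leAs := subset_leq_card As.
by rewrite def_n subKn // subnK.
Qed.

Lemma sigD_sub B v : v \in sig -> v \notin B -> B \subset sig ->
  [/\ v |: B \subset sig, v |: (sig :\: (v |: B)) = sig :\: B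
      & v \notin sig :\: (v |: B)].
Proof.
move=> vs vB Bs; split; first by rewrite subUset sub1set vs.
  apply/setP => w; rewrite !inE.
  by have [->|] := eqVneq w v; rewrite ?vs ?(negbTE vB).
by rewrite !inE eqxx.
Qed.

Lemma sign_setD v T : T \subset sig ->
  (-1) ^+ sgn_exp v (sig :\: T) = (-1) ^+ (sgn_exp v sig + sgn_exp v T) :> k.
Proof.
by move=> Ts; rewrite (sgn_expD v Ts) -addnA addnn exprD -muln2 exprM sqrr_sign mulr1.
Qed.

(** Up to the Koszul sign, the orientation depends only on the block of the new
vertex; the two ways to complete [T] in that block thus differ by no sign. *)
Lemma orient_boundary v T :
  v |: T \subset sig -> v \notin T -> {in T, forall w, bl w != bl v} ->
  (-1) ^+ sgn_exp v (sig :\: (v |: T)) * orient (v |: T) = orient_above (bl v) T.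
Proof.
move=> vTs vT nbl; rewrite sign_setD // sgn_expU1 // ltnn add0n orientU1 // addnC mulrA.
by rewrite -expr2 sqrr_sign mul1r.
Qed.

(** Apart from the comparison of [v] and [w], the right-hand side is symmetric
when the two vertices lie in the same block; the two terms cancel. *)
Lemma orient_coboundary v w T :
  v |: (w |: T) \subset sig -> v \notin w |: T -> w \notin T ->
    {in T, forall u, bl u != bl w} ->
  (-1) ^+ sgn_exp v (sig :\: (v |: (w |: T))) * orient (w |: T)
    = (-1) ^+ (rk v < rk w)%N *
      ((-1) ^+ (sgn_exp v sig + sgn_exp w sig + sgn_exp v T + sgn_exp w T) *
          orient_above (bl w) T).
Proof.
move=> Ts vT wT nbl; rewrite sign_setD // sgn_expU1 // ltnn add0n sgn_expU1 //
    orientU1 //.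
rewrite mulrA -exprD [RHS]mulrA -exprD; congr (_ ^+ _ * _).
by rewrite (addnCA (sgn_exp v sig)) -!addnA; congr (_ + (_ + _))%N; rewrite addnA addnC.
Qed.

Lemma trans_swap v w T : w \notin T -> v \notin T -> bl v = bl w ->
  transversal (w |: T) -> transversal (v |: T).
Proof.
move=> wT vT eq_bl /transP[cT injT]; apply/transP; split.
  by rewrite cardsU1 vT -cT cardsU1 wT.
pose f u := if u == v then w else u.
have fP u : u \in v |: T -> f u \in w |: T /\ bl (f u) = bl u.
  rewrite /f => /setU1P[->|uT]; first by rewrite eqxx setU11.
  by have [eq_uv|_] := eqVneq u v; [rewrite -eq_uv uT in vT | rewrite inE uT orbT].
move=> u u' uT uT' eq_u; have [fu bu] := fP u uT; have [fu' bu'] := fP u' uT'.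
have := injT _ _ fu fu'; rewrite bu bu' => /(_ eq_u).
move: uT uT'; rewrite /f => /setU1P[->|uT] /setU1P[->|uT']; rewrite ?eqxx //.
- have [->|_ eq_w] := eqVneq u' v; first by [].
  by rewrite eq_w uT' in wT.
- have [->|_ eq_w] := eqVneq u v; first by [].
  by rewrite -eq_w uT in wT.
have [eq_uv|_] := eqVneq u v; first by rewrite -eq_uv uT in vT.
by have [eq_uv|_] := eqVneq u' v; first by rewrite -eq_uv uT' in vT.
Qed.

Lemma sum_two (I : finType) (Q : pred I) (f : I -> k) (x y : I) :
  Q x -> Q y -> x != y ->
  (forall z, Q z -> z != x -> z != y -> f z = 0) -> \sum_(z | Q z) f z = f x + f y.
Proof.
move=> Qx Qy neq_xy f0; rewrite (bigD1 x) //= (bigD1 y) /=; last by rewrite Qy eq_sym.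
by rewrite big1 ?addr0 // => z /andP[/andP[Qz zx] zy]; apply: f0.
Qed.

(** Only sets [G] of size [n + 1] matter. If [G] arises from a transversal by
adjoining a vertex outside [X], that vertex is joined to the member of its block,
so the monomial of [G] lies in the ideal. Otherwise [G] has exactly two vertices
in one block, and the terms obtained by removing either of them cancel. *)
Lemma block_cycle_closed B : supported (killed H [set: V]) (D block_cycle B).
Proof.
move=> m; rewrite koszulRE raddf_sum /= => nz.
pose G := sig :\: B.
have termE v : v \notin B -> ((-1) ^+ sgn_exp v B * (var k v * block_cycle (v |:
    B)))@_m != 0 ->
    [/\ B \subset sig, v \in sig, G :\ v \subset X, transversal (G :\ v)
        & m = set_mon G].
  move=> vB; rewrite mcoeffMsign mcoeffXM mulrI_eq0; last first.
    by apply: lregX; apply: lregN; apply: lreg1.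
  case: ifP => [m_v | _]; last by rewrite eqxx.
  have -> : G :\ v = sig :\: (v |: B) by rewrite /G setDDl setUC.
  case/block_cycle_supp => vBs BX tB eq_m; have [vs Bs] : v \in sig /\ B \subset sig.
    by move: vBs; rewrite subUset sub1set => /andP[].
  split=> //; rewrite /G; have [_ <- nvB] := sigD_sub vs vB Bs.
  by rewrite set_monU1 // -eq_m submK // lep1mP -lt0n.
(* All nonzero terms carry the monomial of [G]. *)
have [v0 /andP[v0B nz0] | all0] := pickP (fun v => (v \notin B)
    && (((-1) ^+ sgn_exp v B * (var k v * block_cycle (v |: B)))@_m != 0)); last first.
  case/negP: nz; rewrite big1 // => v /andP[_ vB]; apply/eqP.
  by have := all0 v; rewrite vB => /negbFE.
have [Bs v0s GX tG def_m] := termE v0 v0B nz0.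
have v0G : v0 \in G by rewrite inE v0B.
have Gs : G \subset sig by apply: subsetDl.
have [w0 w0G eq_bl] := trans_onto (subset_trans (subsetDl _ _) Gs) tG (bl_lt v0s).
have /setD1P[neq_w0 w0G'] := w0G.
have w0X : w0 \in X by apply: (subsetP GX).
have [v0X | v0X] := boolP (v0 \in X); last first.
  right; exists w0, v0; rewrite def_m !set_monE v0G w0G'; split=> //.
  by apply: joined => //; apply: (subsetP Gs).
case/negP: nz; pose T := G :\ v0 :\ w0.
have v0T : v0 \notin T by rewrite !inE eqxx !andbF.
have w0T : w0 \notin T by rewrite !inE eqxx.
have defG1 : w0 |: T = G :\ v0 by rewrite setD1K.
have defG : v0 |: (w0 |: T) = G by rewrite defG1 setD1K.
have defG' : w0 |: (v0 |: T) = G by rewrite setUCA.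
have v0T1 : v0 \notin w0 |: T by rewrite defG1 !inE eqxx.
have w0T1 : w0 \notin v0 |: T by rewrite in_setU1 negb_or neq_w0.
have defG2 : v0 |: T = G :\ w0 by rewrite -defG' setU1K.
have defB : sig :\: G = B by rewrite /G setDDr setDv set0U (setIidPr Bs).
have tG2 : transversal (G :\ w0).
  by rewrite -defG2; apply: (trans_swap w0T) => //; rewrite defG1.
have GX2 : G :\ w0 \subset X.
  apply/subsetP => u; rewrite -defG2 => /setU1P[->//|uT].
  by apply: (subsetP GX); rewrite -defG1 inE uT orbT.
have nbl : {in T, forall u, bl u != bl w0}.
  move=> u uT; apply: contraNneq w0T => eq_u.
  have /transP[_ injG] := tG; have <- // : u = w0.
  by apply: injG => //; rewrite -defG1 inE uT orbT.
have value v : v \in G -> G :\ v \subset X -> transversal (G :\ v) ->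
    ((-1) ^+ sgn_exp v B * (var k v * block_cycle (v |: B)))@_m = (-1) ^+ sgn_exp v B
        * orient (G :\ v).
  move=> vG vX tv; rewrite mcoeffMsign mcoeffXM def_m set_monE vG /=.
  have /setDP[vs vB] := vG; have [vBs eqG nvB] := sigD_sub vs vB Bs.
  have defGv : G :\ v = sig :\: (v |: B) by rewrite /G setDDl setUC.
  rewrite /G -{1}eqG set_monU1 // addmK block_cycle_coeff -?defGv //.
rewrite (sum_two (x := v0) (y := w0)); first last.
- move=> v /andP[_ vB] neq_v0 neq_w; apply/eqP;
    apply: contraT => /(termE v vB)[_ vs _ tv _].
  have vG : v \in G by rewrite inE vB.
  have [|eq_v|eq_v] := @trans_partner G v0 w0 v0G w0G' _ (esym eq_bl) tG v vG tv.
  - by rewrite eq_sym.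
  - by rewrite eq_v eqxx in neq_v0.
  - by rewrite eq_v eqxx in neq_w.
- by rewrite eq_sym.
- by move: w0G'; rewrite in_setT inE => /andP[].
- by rewrite in_setT.
rewrite !value // -defG1 -defG2.
have -> : sgn_exp v0 B = sgn_exp v0 (sig :\: (v0 |: (w0 |: T))) by rewrite defG defB.
have -> : sgn_exp w0 B = sgn_exp w0 (sig :\: (w0 |: (v0 |: T))) by rewrite defG' defB.
rewrite orient_coboundary ?defG // orient_coboundary ?defG' //; last first.
  by move=> u uT; rewrite -eq_bl nbl.
rewrite eq_bl (addnC (sgn_exp w0 sig)) (addnAC _ (sgn_exp w0 T)) -mulrDl.
have : rk v0 != rk w0 :> nat by rewrite (inj_eq val_inj) (inj_eq enum_rank_inj) eq_sym.
by case: ltngtP => // _ _; rewrite ?subrr ?addNr mul0r.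
Qed.

Definition cross_trans T := (T \subset cross) && transversal T.

(** Evaluation on the fundamental cycle of the cross-polytope whose pairs of
antipodal vertices are [al t] and [be t]. *)
Definition pairing c : k := \sum_(T | cross_trans T)
  (-1) ^+ #|T :\: X| * orient T * (c (sig :\: T))@_(set_mon T).

Lemma cross_sub : cross \subset sig.
Proof. by apply/subsetP => v; rewrite inE => /andP[]. Qed.

(** A transversal of the cross-polytope is an independent set. *)
Lemma pairing_killed c :
  (forall A, supported (killed H [set: V]) (c A)) -> pairing c = 0.
Proof.
move=> bad_c; rewrite /pairing big1 // => T /andP[/subsetP TP /transP[_ injT]].
have [-> | /bad_c] := eqVneq (c (sig :\: T))@_(set_mon T) 0; first by rewrite mulr0.
case=> [[v] | [u [v [uv]]]]; first by rewrite inE.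
rewrite !set_monE; case uT: (u \in T) => // _; case vT: (v \in T) => // _.
have [/injT eq_uv | /(apart (TP u uT) (TP v vT))] := eqVneq (bl u) (bl v).
  by rewrite eq_uv // adj_irrefl in uv.
by rewrite uv.
Qed.

Lemma pairingB c c' : pairing (fun A => c A - c' A) = pairing c - pairing c'.
Proof. by rewrite -sumrB; apply: eq_bigr => T _; rewrite mcoeffB mulrBr. Qed.

(** A set of vertices missing one block lies in exactly two facets of the
cross-polytope, with opposite signs. *)
Lemma pairing_boundary b : pairing (D b) = 0.
Proof.
(* [F v T] is the contribution of the facet [v |: T] and its ridge [T]. *)
pose F v T := (-1) ^+ #|(v |: T) :\: X| * orient_above (bl v) T * (b (sig :\:
    T))@_(set_mon T).
transitivity (\sum_(T : {set V}) \sum_(v : V | (v \notin T) && cross_trans (v |: T))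
    F v T).
  transitivity (\sum_(T : {set V} | cross_trans T) \sum_(v in T) F v (T :\ v)).
    apply: eq_bigr => T /andP[TP tT]; rewrite koszulRE raddf_sum /= mulr_sumr.
    have Ts := subset_trans TP cross_sub.
    rewrite (bigID (mem T)) /= [X in _ + X]big1 ?addr0; last first.
      move=> v /andP[_ vT]; rewrite mcoeffMsign mcoeffXM set_monE (negbTE vT) /=.
      by rewrite !mulr0.
    apply: eq_big => [v|v /andP[_ vT]]; first by rewrite !inE andbC; case: (v \in T).
    have vTv : v \notin T :\ v by rewrite !inE eqxx.
    have defT : v |: (T :\ v) = T by rewrite setD1K.
    have def_s : v |: (sig :\: T) = sig :\: (T :\ v).
      apply/setP => w; rewrite !inE; have [->|] := eqVneq w v => //=.
      by rewrite (subsetP Ts).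
    rewrite mcoeffMsign mcoeffXM set_monE vT /= def_s -{2 4}defT set_monU1 // addmK.
    rewrite /F -{3}defT mulrA; congr (_ * _); rewrite -mulrA; congr (_ * _).
      by rewrite defT.
    rewrite -{2}defT mulrC -{2}defT orient_boundary ?defT // => w /setD1P[neq_w wT].
    by apply: contraNneq neq_w => eq_bl; have /transP[_ injT] := tT; apply/eqP/injT.
  rewrite (exchange_big_dep predT) //= [RHS](exchange_big_dep predT) //=.
  apply: eq_bigr => v _; rewrite (reindex_onto (fun T => v |: T) (fun T =>
      T :\ v)) /=; last first.
    by move=> T /andP[_ vT]; rewrite setD1K.
  apply: eq_big => [T|T /andP[/andP[_ _] /eqP ->]] //.
  rewrite setU11 andbT andbC; congr (_ && _); apply/eqP/idP => [<-|vT].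
    by rewrite !inE eqxx.
  by rewrite setU1K.
apply: big1 => T _.
have [v0 /andP[v0T /andP[v0P tv0]] | no_v] := pickP (fun v =>
    (v \notin T) && cross_trans (v |: T)); last first.
  by rewrite big_pred0.
have v0_P : v0 \in cross by apply: (subsetP v0P); apply: setU11.
have TP : T \subset cross by apply: subset_trans v0P; apply: subsetUr.
have v0s : v0 \in sig := subsetP cross_sub _ v0_P.
have [als alX bl_al] := alP (bl_lt v0s); have [bes beX bl_be] := beP (bl_lt v0s).
set a := al (bl v0) in als alX bl_al; set b0 := be (bl v0) in bes beX bl_be.
have newT w : bl w = bl v0 -> w \notin T.
  move=> eq_bl; apply/negP => wT; have /transP[_ injT] := tv0.
  case/negP: v0T; rewrite -(injT w v0) ?setU11 // inE wT orbT //.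
have nblT w : bl w = bl v0 -> {in T, forall u, bl u != bl w}.
  by move=> eq_bl u uT; apply: contraTneq uT => eq_u; apply: newT; rewrite eq_u.
have crossT w : w \in cross -> bl w = bl v0 -> (w \notin T) && cross_trans (w |: T).
  move=> wP eq_bl; rewrite newT //= /cross_trans subUset sub1set wP TP /=.
  by apply: (trans_swap v0T) => //; apply: newT.
have aP : a \in cross by rewrite inE als bl_al eqxx.
have bP : b0 \in cross by rewrite inE bes bl_be eqxx orbT.
rewrite (sum_two (x := a) (y := b0)) ?crossT //; last first.
- move=> w /andP[wT /andP[wP tw]] neq_a neq_b; exfalso.
  have eq_bl : bl w = bl v0.
    have [u] := trans_onto (subset_trans wP cross_sub) tw (bl_lt v0s).
    case/setU1P=> [-> //|uT eq_u]; have := nblT v0 (erefl _) u uT.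
    by rewrite eq_u eqxx.
  have : w \in cross by apply: (subsetP wP); apply: setU11.
  by rewrite inE eq_bl (negbTE neq_a) (negbTE neq_b) andbF.
- by apply: contraNneq beX => <-.
rewrite /F bl_al bl_be -!mulrA -mulrDl.
have aT := newT a bl_al; have bT := newT b0 bl_be.
have -> : (a |: T) :\: X = T :\: X.
  by apply/setP => w; rewrite !inE; have [->|] := eqVneq w a; rewrite ?alX ?andbF.
have -> : (b0 |: T) :\: X = b0 |: (T :\: X).
  by apply/setP => w; rewrite !inE; have [->|] := eqVneq w b0; rewrite ?beX ?andbT.
by rewrite cardsU1 !inE (negbTE bT) andbF /= exprS mulN1r subrr mul0r.
Qed.

(** The only facet of the cross-polytope contained in [X] consists of all the
[al t]. *)
Lemma pairing_block_cycle : pairing block_cycle != 0.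
Proof.
pose T0 := [set v in cross | v \in X].
have T0al v : v \in T0 -> v = al (bl v).
  rewrite !inE => /andP[/andP[vs /orP[/eqP //|/eqP eq_v]] vX].
  by have [_ + _] := beP (bl_lt vs); rewrite -eq_v vX.
have alT0 t : (t < n)%N -> al t \in T0.
  by case/alP=> als alX bl_al; rewrite !inE als alX bl_al eqxx.
have cT0 : #|T0| = n.
  have -> : T0 = [set al (i : 'I_n) | i : 'I_n].
    apply/setP => v; apply/idP/imsetP => [vT0 | [i _ ->]]; last exact: alT0.
    have vs : v \in sig by move: vT0; rewrite !inE => /andP[/andP[]].
    by exists (Ordinal (bl_lt vs)) => //=; apply: T0al.
  rewrite card_imset ?card_ord // => i j eq_ij; apply: val_inj => /=.
  have [_ _ <-] := alP (ltn_ord i); rewrite eq_ij.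
  by have [_ _ ->] := alP (ltn_ord j).
have tT0 : transversal T0.
  by apply/transP; split=> // v w /T0al Ev /T0al Ew eq_bl; rewrite Ev eq_bl -Ew.
have T0P : T0 \subset cross by apply/subsetP => v; rewrite inE => /andP[].
have sigK T : T \subset cross -> sig :\: (sig :\: T) = T.
  by move=> TP; rewrite setDDr setDv set0U (setIidPr (subset_trans TP cross_sub)).
rewrite /pairing (bigD1 T0) /=; last by rewrite /cross_trans T0P.
rewrite big1 ?addr0 => [|T /andP[/andP[TP /transP[cT _]] neqT]]; last first.
  have [-> | /block_cycle_supp[_]] := eqVneq (block_cycle (sig :\: T))@_(set_mon T)
      0; first by rewrite mulr0.
  rewrite sigK // => TX _ _; case/negP: neqT; rewrite eqEcard cT cT0 leqnn andbT.
  apply/subsetP => v vT; rewrite inE (subsetP TX) // andbT; exact: (subsetP TP).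
have -> : (block_cycle (sig :\: T0))@_(set_mon T0) = orient T0.
  have := @block_cycle_coeff (sig :\: T0); rewrite sigK //; apply; rewrite ?subsetDl //.
  by apply/subsetP => v; rewrite inE => /andP[].
by rewrite -mulrA sqr_orient mulr1 signr_eq0.
Qed.

Theorem block_cycle_nonboundary :
  ~ exists b, forall A, supported (killed H [set: V]) (block_cycle A - D b A).
Proof.
case=> b bad_b; have := pairing_killed bad_b.
by rewrite pairingB pairing_boundary subr0 => /eqP;
    rewrite (negbTE pairing_block_cycle).
Qed.

End BlockCycle.

(** * Staircase graphs and the algorithm *)

Section Staircase.
Variables (m : nat) (H : sgraph ('I_m + 'I_m)%type).
Local Notation V := ('I_m + 'I_m)%type.
Implicit Types (K S N : {set V}) (U M : {set {set V}}) (i j a b : 'I_m).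

(** The x-neighbourhoods are intervals starting at the diagonal, with ends that
move monotonically. *)
Definition staircase : Prop :=
  [/\ forall i i', ~~ H (inl i) (inl i'),
      forall j j', ~~ H (inr j) (inr j'),
      forall i, H (inl i) (inr i)
    & forall i i' j j', H (inl i) (inr j) ->
        i <= j /\ (i <= i' -> i' <= j' -> j' <= j -> H (inl i') (inr j'))].

Hypothesis stairH : staircase.

Let Hxx i i' : H (inl i) (inl i') = false.
Proof. by case: stairH => h _ _ _; apply/negbTE. Qed.
Let Hyy j j' : H (inr j) (inr j') = false.
Proof. by case: stairH => _ h _ _; apply/negbTE. Qed.
Let Hii i : H (inl i) (inr i).
Proof. by case: stairH. Qed.
Let Hle i j : H (inl i) (inr j) -> i <= j.
Proof. by case: stairH => _ _ _ h /h-/(_ i j)[]. Qed.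
Let Hin i j i' j' : H (inl i) (inr j) -> i <= i' -> i' <= j' -> j' <= j ->
  H (inl i') (inr j').
Proof. by case: stairH => _ _ _ h /h-/(_ i' j')[]. Qed.
Let Hsym u v : H u v = H v u. Proof. exact: adj_sym. Qed.

(** Let [b] be the last index of a y with a neighbour in [T] and [q] the first
neighbour of [b]. If x_i is joined to y_j and to y_b, then [q <= i <= j <= b], so
y_j is a neighbour of x_q. *)
Lemma staircase_peelable : peelable H.
Proof.
move=> T u0 v0 u0T v0T uv0.
have [i0 [j0 [i0T j0T ij0]]] : exists i j, [/\ inl i \in T, inr j \in T
    & H (inl i) (inr j)].
  case: u0 v0 u0T v0T uv0 => [i|j] [i'|j']; rewrite ?Hxx ?Hyy // => uT vT uv.
    by exists i, j'.
  by exists i', j; rewrite Hsym.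
pose Q j := (inr j \in T) && [exists i, (inl i \in T) && H (inl i) (inr j)].
have Qj0 : Q j0 by rewrite /Q j0T; apply/existsP; exists i0; rewrite i0T.
case: (arg_maxnP (fun j : 'I_m => j : nat) Qj0) => b /andP[bT /existsP[q0 q0b]] max_b.
case: (arg_minnP (P := fun i => (inl i \in T) && H (inl i) (inr b)) (fun i : 'I_m =>
    i : nat) q0b).
move=> q /andP[qT qb] min_q.
exists (inl q), (inr b); split=> // u v uT vT uv wu wv.
wlog [i [j [Eu Ev]]] : u v uT vT uv wu wv / exists i j, u = inl i /\ v = inr j.
  move=> IH; case: u v uT vT uv wu wv => [i|j] [i'|j'] uT vT uv wu wv.
  - by rewrite Hxx in uv.
  - by apply: IH => //; exists i, j'.
  - by rewrite andbC; apply: IH => //; [rewrite Hsym | exists i', j].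
  - by rewrite Hyy in uv.
rewrite {}Eu {}Ev in uT vT uv wu wv *; rewrite Hyy andbT.
apply: contra wv => ib; apply: (Hin qb) => //.
  by apply: leq_trans (Hle uv); apply: min_q; rewrite uT.
by apply: max_b; rewrite /Q vT; apply/existsP; exists i; rewrite uT.
Qed.

(** The shape shared by all graphs that the algorithm meets; it guarantees that
the last x and the last y are adjacent. *)
Definition balanced K : Prop :=
  (forall i, inl i \in K -> inr i \in K) /\
  (forall j, inr j \in K -> exists2 i, inl i \in K & H (inl i) (inr j)).

Lemma largest_xP K i : inl i \in K -> exists2 a, largest_x K = Some a &
  inl a \in K /\ forall i', inl i' \in K -> i' <= a.
Proof.
move=> iK; rewrite /largest_x; case: pickP => [a /andP[aK /forallP max_a] | no_a].
  by exists a => //; split=> // i'; apply/implyP.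
case: (arg_maxnP (P := fun i => inl i \in K) (fun i : 'I_m => i : nat) iK) =>
    a aK max_a.
have /negP[] := negbT (no_a a); rewrite aK; apply/forallP => i'.
by apply/implyP; apply: max_a.
Qed.

Lemma largest_yP K j : inr j \in K -> exists2 b, largest_y K = Some b &
  inr b \in K /\ forall j', inr j' \in K -> j' <= b.
Proof.
move=> jK; rewrite /largest_y; case: pickP => [b /andP[bK /forallP max_b] | no_b].
  by exists b => //; split=> // j'; apply/implyP.
case: (arg_maxnP (P := fun j => inr j \in K) (fun j : 'I_m => j : nat) jK) =>
    b bK max_b.
have /negP[] := negbT (no_b b); rewrite bK; apply/forallP => j'.
by apply/implyP; apply: max_b.
Qed.

(** The outcome of running the algorithm on the subgraph induced on [K]: the
function [bl] numbers the pass that removes a vertex into its set [N], and [al t],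
[be t] are the vertices picked in pass [t]. *)
Record decomposition K U S n (bl : V -> nat) (al be : nat -> 'I_m) :
    Prop := Decomposition {
  dec_sub : S \subset K;
  dec_x : forall i, inl i \notin S;
  dec_lt : forall v, v \in K :\: S -> bl v < n;
  dec_al : forall t, t < n -> inl (al t) \in K /\ bl (inl (al t)) = t;
  dec_be : forall t, t < n -> inr (be t) \in K :\: S /\ bl (inr (be t)) = t;
  dec_U : U = [set [set inl (al t); inr (be t)] | t : 'I_n];
  dec_joined : forall i j, inl i \in K -> inr j \in K :\: S ->
    bl (inl i) = bl (inr j) -> H (inl i) (inr j);
  dec_apart : forall t t', t < n -> t' < n -> t != t' ->
      ~~ H (inl (al t)) (inr (be t'));
  dec_max : forall M, induced_matching H M -> (forall e, e \in M ->
      e \subset K) -> #|M| <= n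
}.

Lemma decomposition0 bl al be : decomposition set0 set0 set0 0 bl al be.
Proof.
split=> //.
- by move=> i; rewrite inE.
- by move=> v; rewrite !inE.
- by apply/setP => e; rewrite inE; apply/esym/negP => /imsetP[[]].
- by move=> i j; rewrite inE.
move=> M /induced_matchingP[edgeM _] subM; rewrite leqn0 cards_eq0.
apply/eqP/setP => e; rewrite inE; apply/negP => eM.
have [u [v [_ def_e]]] := edgeM e eM; have /subsetP/(_ u) := subM e eM.
by rewrite def_e set21 inE => /(_ isT).
Qed.

Section Step.
Variables (K : {set V}) (a b : 'I_m).
Hypotheses (balK : balanced K) (aK : inl a \in K) (bK : inr b \in K).
Hypotheses (max_a : forall i, inl i \in K -> i <= a).
Hypotheses (max_b : forall j, inr j \in K -> j <= b).
Let N := nbhd_in H K (inl a) :|: nbhd_in H K (inr b).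
Let iso := isolated_y H (K :\: N).
Let K1 := (K :\: N) :\: iso.

Lemma top_edge : H (inl a) (inr b).
Proof.
have [i iK ib] := balK.2 b bK; apply: (Hin ib) => //; first exact: max_a.
by apply/max_b/balK.1.
Qed.

Lemma mem_nbhd_x i : (inl i \in N) = (inl i \in K) && H (inl i) (inr b).
Proof. by rewrite !inE Hxx andbF (Hsym (inr b)). Qed.

Lemma mem_nbhd_y j : (inr j \in N) = (inr j \in K) && H (inl a) (inr j).
Proof. by rewrite !inE Hyy andbF orbF. Qed.

Lemma isolated_yP v : reflect (exists2 j, v = inr j &
     inr j \in K :\: N /\ forall i, inl i \in K :\: N -> ~~ H (inl i) (inr j))
   (v \in iso).
Proof.
rewrite inE; apply: (iffP and3P) => [[vK v_y /eqP nb0] | [j -> [jK nb]]].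
  case: v vK v_y nb0 => // j jK _ nb0; exists j => //; split=> // i iK.
  apply/negP => ij; have /setP/(_ (inl i)) := nb0.
  by rewrite in_set0 inE iK Hsym ij.
split=> //; apply/eqP/setP => -[i|j']; rewrite in_set0 inE ?Hyy ?andbF //.
by apply/negP => /andP[iK ij]; have := nb i iK; rewrite Hsym ij.
Qed.

Lemma mem_rest_x i : (inl i \in K1) = (inl i \in K :\: N).
Proof. by rewrite in_setD; case: isolated_yP => // -[]. Qed.

Lemma x_lt i : inl i \in K :\: N -> i < a.
Proof.
rewrite inE => /andP[iN iK]; rewrite ltn_neqAle max_a // andbT.
by apply: contraNneq iN => /val_inj ->; rewrite mem_nbhd_x aK top_edge.
Qed.

Lemma balanced_step : balanced K1.
Proof.
split=> [i | j]; rewrite ?mem_rest_x.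
  move=> iK1; have /setDP[iK _] := iK1; rewrite in_setD; apply/andP; split.
    by apply/negP => /isolated_yP[j [<-] [_ /(_ i iK1)]]; rewrite Hii.
  rewrite in_setD balK.1 // andbT mem_nbhd_y negb_and; apply/orP; right.
  by apply: contraL (x_lt iK1) => /Hle; rewrite -leqNgt.
case/setDP=> jK /isolated_yP no; have [i /andP[iK ij]|none] := pickP (fun i =>
    (inl i \in K :\: N) && H (inl i) (inr j)).
  by exists i; rewrite ?mem_rest_x.
by case: no; exists j => //; split=> // i iK; have := none i; rewrite iK => /negbT.
Qed.

(** The pass becomes block 0. It is complete bipartite because x_i adjacent to y_b
and y_j adjacent to x_a force [i <= a <= j <= b]. The staircase shape also makes
any two disjoint edges that meet it adjacent, so it contributes at most one edge
to an induced matching. *)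
Lemma decomposition_step U S n bl al be : decomposition K1 U S n bl al be ->
  decomposition K ([set inl a; inr b] |: U) (iso :|: S) n.+1
    (fun v => if v \in N then 0 else (bl v).+1)
    (fun t => if t is t'.+1 then al t' else a)
    (fun t => if t is t'.+1 then be t' else b).
Proof.
move=> dec; have isoK : iso \subset K :\: N.
  by apply/subsetP => v; rewrite inE => /andP[].
have K1K : K1 \subset K by rewrite /K1 setDDl subsetDl.
have K1N v : v \in K1 -> v \notin N by case/setDP=> /setDP[].
have K1iso v : v \in K1 -> v \notin iso by case/setDP.
have [subS xS lt_n al_n be_n defU joinS apartS maxS] := dec.
have aN : inl a \in N by rewrite mem_nbhd_x aK top_edge.
have bN : inr b \in N by rewrite mem_nbhd_y bK top_edge.
have isoN v : v \in N -> v \notin iso.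
  by move=> vN; apply: contraL vN => /(subsetP isoK)/setDP[].
have SN v : v \in N -> v \notin S.
  by move=> vN; apply: contraL vN => /(subsetP subS)/K1N.
have restK v : v \in K :\: (iso :|: S) -> v \notin N -> v \in K1 :\: S.
  case/setDP=> vK; rewrite in_setU => /norP[niso nS] vN.
  by apply/setDP; split; [apply/setDP; split; [apply/setDP|] |].
have xrest i : inl i \in K -> inl i \in K :\: (iso :|: S).
  move=> iK; rewrite in_setD iK in_setU (negbTE (xS i)) orbF andbT.
  by apply/isolated_yP => -[].
split.
- rewrite subUset (subset_trans isoK (subsetDl _ _)) /=.
  exact: subset_trans subS K1K.
- by move=> i; rewrite in_setU negb_or xS andbT; apply/isolated_yP => -[].
- by move=> v vK; case: ifPn => // /(restK v vK)/lt_n.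
- case=> [|t]; first by rewrite aN.
  by rewrite ltnS => /al_n[alK bl_t]; rewrite (subsetP K1K) // (negbTE (K1N _ alK))
      bl_t.
- case=> [|t] => [_|]; first by rewrite bN in_setD in_setU bK (negbTE (isoN _ bN))
    (negbTE (SN _ bN)).
  rewrite ltnS => /be_n[/setDP[beK beS] bl_t].
  by rewrite (negbTE (K1N _ beK)) bl_t !in_setD in_setU (negbTE beS) (negbTE (K1iso _
      beK)) (subsetP K1K).
- apply/setP => e; rewrite defU; apply/setU1P/imsetP =>
    [[->|/imsetP[t _ ->]] | [t _ ->]].
  + by exists ord0.
  + by exists (lift ord0 t).
  case: (unliftP ord0 t) => [t' ->|->]; last by left.
  by right; apply/imsetP; exists t'.
- move=> i j iK jK; case: ifPn => [iN|iN]; case: ifPn => [jN|jN] //.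
    have := iN; rewrite mem_nbhd_x iK /= => ib _; have := jN;
        rewrite mem_nbhd_y => /andP[jK' aj].
    apply: (Hin ib) => //; last exact: max_b.
    exact: leq_trans (max_a iK) (Hle aj).
  move=> [eq_bl]; apply: joinS => //; last exact: restK.
  by have /setDP[] := restK _ (xrest i iK) iN.
- case=> [|t] [|t'] //; rewrite ?ltnS.
  + move=> _ /be_n[/setDP[beK _] _] _; have := K1N _ beK.
    by rewrite mem_nbhd_y (subsetP K1K _ beK).
  + by move=> /al_n[alK _] _ _; have := K1N _ alK;
      rewrite mem_nbhd_x (subsetP K1K _ alK).
  exact: apartS.
move=> M indM subM; pose M1 := [set e in M | [disjoint e & N]].
have subM1 : M1 \subset M by apply/subsetP => e; rewrite inE => /andP[].
have /induced_matchingP[edgeM sepM] := indM.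
have edgeK e : e \in M -> exists i j, [/\ H (inl i) (inr j), e = [set inl i; inr j],
     inl i \in K & inr j \in K].
  move=> eM; have [u [v [uv def_e]]] := edgeM e eM; have := subsetP (subM e eM).
  rewrite def_e => sub_e; have := sub_e u (set21 u v); have := sub_e v (set22 u v).
  case: u v uv {sub_e def_e} (def_e) => [i|j] [i'|j'] uv def_e vK uK.
  - by rewrite Hxx in uv.
  - by exists i, j'.
  - by exists i', j; rewrite Hsym setUC.
  - by rewrite Hyy in uv.
have cardM1 : #|M1| <= n.
  apply: maxS (induced_matching_sub subM1 indM) _ => e.
  rewrite inE => /andP[eM dis_e]; have [i [j [ij def_e iK jK]]] := edgeK e eM.
  have [iN jN] : inl i \notin N /\ inr j \notin N.
    by move: dis_e; rewrite def_e => /disjointFr dis; rewrite !dis ?set21 ?set22.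
  have iKN : inl i \in K :\: N by rewrite in_setD iN.
  rewrite def_e subUset !sub1set mem_rest_x iKN [inr j \in K1]in_setD [inr j \in K
      :\: N]in_setD jN jK !andbT /=.
  by apply/isolated_yP => -[j' [<-] [_ /(_ i iKN)]]; rewrite ij.
have cardM2 : #|M :\: M1| <= 1.
  apply/card_le1_eqP => e f /setDP[eM eM1] /setDP[fM fM1].
  apply/eqP; rewrite eq_sym; apply: contraT => neq_ef.
  have meet g : g \in M -> g \notin M1 -> exists i j, [/\ H (inl i) (inr j),
      g = [set inl i; inr j], inl i \in K, inr j \in K
          & H (inl i) (inr b) || H (inl a) (inr j)].
    move=> gM; rewrite inE gM /=; have [i [j [ij def_g iK jK]]] := edgeK g gM.
    rewrite def_g => meetN; exists i, j; split=> //;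
        apply: contraR meetN => /norP[ib aj].
    rewrite disjoints_subset subUset !sub1set !inE.
    by rewrite !Hxx !Hyy !andbF orbF /= (Hsym (inr b)) (negbTE ib) (negbTE aj) !andbF.
  have [i [j [ij def_e iK jK meet_e]]] := meet e eM eM1.
  have [i' [j' [ij' def_f iK' jK' meet_f]]] := meet f fM fM1.
  wlog lt_ii : e f eM fM neq_ef i j i' j' ij def_e iK jK meet_e ij' def_f iK' jK'
      meet_f {eM1 fM1} / i < i'.
    move=> IH; case: (ltngtP i i') => [lt_ii|lt_ii|/val_inj eq_ii].
    - exact: (IH e f eM fM neq_ef i j i' j').
    - by apply: (IH f e fM eM _ i' j' i j) => //; rewrite eq_sym.
    have [] := sepM e f eM fM neq_ef (inl i) (inl i).
    - by rewrite def_e set21.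
    - by rewrite def_f eq_ii set21.
    by rewrite eqxx.
  have [ie je] : inl i \in e /\ inr j \in e by rewrite def_e set21 set22.
  have [if' jf] : inl i' \in f /\ inr j' \in f by rewrite def_f set21 set22.
  case/orP: meet_e => [ib | aj].
    have [_] := sepM e f eM fM neq_ef _ _ ie jf.
    rewrite (Hin ib) //; last exact: max_b.
    exact: leq_trans (ltnW lt_ii) (Hle ij').
  have [_] := sepM e f eM fM neq_ef _ _ je if'.
  rewrite Hsym (Hin ij) ?(ltnW lt_ii) //.
  exact: leq_trans (max_a iK') (Hle aj).
by rewrite -(cardsID M1 M) (setIidPr subM1) addnC -add1n leq_add.
Qed.

End Step.

Lemma algorithm_loopP (o : 'I_m) fuel K U0 S0 :
  balanced K -> #|K| <= fuel -> [disjoint S0 & K] ->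
  exists U S n bl al be, algorithm_loop H fuel K U0 S0 = (U :|: U0, S0 :|: S)
    /\ decomposition K U S n bl al be.
Proof.
pose bl0 (v : V) := 0; pose al0 (t : nat) := o.
elim: fuel K U0 S0 => [|fuel IH] K U0 S0 balK leK disS.
  move: leK; rewrite leqn0 cards_eq0 => /eqP ->; exists set0, set0, 0, bl0, al0, al0.
  by rewrite set0U setU0; split=> //; apply: decomposition0.
have [-> | [v vK]] := set_0Vmem K.
  exists set0, set0, 0, bl0, al0, al0; rewrite set0U setU0; split;
      last exact: decomposition0.
  by rewrite /= /largest_x; case: pickP => // a; rewrite inE.
have [i0 i0K] : exists i, inl i \in K.
  by case: v vK => [i|j] vK; [exists i | have [i] := balK.2 j vK; exists i].
have [a def_a [aK max_a]] := largest_xP i0K.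
have [b def_b [bK max_b]] := largest_yP (balK.1 a aK).
rewrite /= def_a def_b; set N := nbhd_in H K (inl a) :|: nbhd_in H K (inr b).
set iso := isolated_y H (K :\: N).
have -> : K :\: (S0 :|: iso :|: N) = (K :\: N) :\: iso.
  apply/setP => w; rewrite !inE; case wK: (w \in K); rewrite ?andbF // !andbT.
  by rewrite (disjointFl disS wK) /= negb_or.
have aN : inl a \in N by rewrite /N mem_nbhd_x aK (top_edge balK aK bK max_a max_b).
have [||| U [S [n [bl [al [be [-> dec]]]]]]] :=
    IH ((K :\: N) :\: iso) ([set inl a; inr b] |: U0) (S0 :|: iso).
- exact: balanced_step.
- rewrite -ltnS; apply: leq_trans leK; apply: proper_card; apply/properP.
  split; first by rewrite setDDl subsetDl.
  by exists (inl a); rewrite // !in_setD aN andbF.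
- rewrite disjoint_subset; apply/subsetP => w; rewrite !inE => /orP[wS | ->//].
  by rewrite (disjointFr disS wS) !andbF.
do 6!eexists; split; last exact: decomposition_step dec.
by congr (_, _); [rewrite setUCA setUA | rewrite setUA].
Qed.

Lemma algorithmP (o : 'I_m) : exists n bl al be,
  decomposition [set: V] (algorithm H).1 (algorithm H).2 n bl al be.
Proof.
have [|||U [S [n [bl [al [be [def_US dec]]]]]]] :=
  @algorithm_loopP o #|{: V}| [set: V] set0 set0.
- split=> [i _|j _]; rewrite ?inE //.
  by exists j; rewrite ?inE.
- by rewrite cardsT.
- by rewrite disjoints_subset sub0set.
by exists n, bl, al, be; rewrite /algorithm def_US setU0 set0U.
Qed.

Lemma dec_matching K U S n bl al be : decomposition K U S n bl al be ->
  induced_matching H U /\ #|U| = n.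
Proof.
case=> _ _ _ al_n be_n -> joinS apartS _.
have bl_e (t : 'I_n) v : v \in [set inl (al t); inr (be t)] -> bl v = t.
  by have [_ bla] := al_n t (ltn_ord t);
      have [_ blb] := be_n t (ltn_ord t) => /set2P[] ->.
split; last first.
  rewrite card_imset ?card_ord // => t t' eq_e; apply: val_inj => /=.
  by rewrite -(bl_e t' (inl (al t))) -?eq_e ?set21 // (bl_e t) ?set21.
apply/induced_matchingP; split=> [e /imsetP[t _ ->]|].
  exists (inl (al t)), (inr (be t)); split=> //.
  have [alK bla] := al_n t (ltn_ord t); have [beK blb] := be_n t (ltn_ord t).
  by apply: joinS; rewrite ?bla ?blb.
move=> _ _ /imsetP[t _ ->] /imsetP[t' _ ->] neq_e u v ue ve.
have neq_t : t != t' :> nat by apply: contraNneq neq_e => /val_inj ->.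
split; first by apply: contraNneq neq_t => eq_uv;
    rewrite -(bl_e t u) // -(bl_e t' v) // eq_uv.
case/set2P: ue ve => -> /set2P[] ->; rewrite ?Hxx ?Hyy //.
  exact: apartS.
by rewrite Hsym; apply: apartS; rewrite // eq_sym.
Qed.

End Staircase.

(** * Connected closed graphs *)

Section ClosedGraph.
Variables (n : nat) (G : sgraph 'I_n).
Hypotheses (G_closed : closed_graph G) (G_conn : connected G).
Implicit Types (i j u v w t : 'I_n).

Definition up := [rel u v : 'I_n | G u v && (u < v)].
Definition down := [rel u v : 'I_n | G u v && (v < u)].

Lemma edge_cmp u v : G u v -> (u < v) || (v < u).
Proof.
by case: (ltngtP u v) => // /val_inj ->; rewrite adj_irrefl.
Qed.

(** If the edge leaves [v] on the side from which the path arrived, closedness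
replaces [v] by its predecessor; if it leaves on the other side, it extends the
path. *)
Lemma up_step t v w : connect up t v -> G v w -> connect up t w || connect down t w.
Proof.
case/connectP => p; elim/last_ind: p v w => [|p v' IHp] v w /=.
  move=> _ -> tw; have /orP[lt_tw|lt_wt] := edge_cmp tw; apply/orP.
    by left; apply: connect1; rewrite /= tw.
  by right; apply: connect1; rewrite /= tw.
rewrite rcons_path last_rcons => /andP[pth /andP[uv lt_uv]] -> vw.
have up_u : connect up t (last t p) by apply/connectP; exists p.
have /orP[lt_vw|lt_wv] := edge_cmp vw.
  apply/orP; left; apply: connect_trans up_u (connect_trans (y := v') _ _).
    by apply: connect1; rewrite /= uv.
  by apply: connect1; rewrite /= vw.
have [<-|neq_uw] := eqVneq (last t p) w; first by rewrite up_u.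
apply: IHp pth (erefl _) _; apply: (G_closed neq_uw (i := v')) => //.
  by rewrite adj_sym.
by rewrite lt_uv lt_wv orbT.
Qed.

(** The mirror image of [up_step]. *)
Lemma down_step t v w : connect down t v -> G v w -> connect up t w || connect down t w.
Proof.
case/connectP => p; elim/last_ind: p v w => [|p v' IHp] v w /=.
  move=> _ -> tw; have /orP[lt_tw|lt_wt] := edge_cmp tw; apply/orP.
    by left; apply: connect1; rewrite /= tw.
  by right; apply: connect1; rewrite /= tw.
rewrite rcons_path last_rcons => /andP[pth /andP[uv lt_uv]] -> vw.
have down_u : connect down t (last t p) by apply/connectP; exists p.
have /orP[lt_vw|lt_wv] := edge_cmp vw; last first.
  apply/orP; right; apply: connect_trans down_u (connect_trans (y := v') _ _).
    by apply: connect1; rewrite /= uv.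
  by apply: connect1; rewrite /= vw.
have [<-|neq_uw] := eqVneq (last t p) w; first by rewrite down_u orbT.
apply: IHp pth (erefl _) _; apply: (G_closed neq_uw (i := v')) => //.
  by rewrite adj_sym.
by rewrite lt_uv lt_vw.
Qed.

Lemma monotone_connect t v : connect up t v || connect down t v.
Proof.
have /connectP[p pth ->] := G_conn (in_setT t) (in_setT v).
have {pth} pth : path G t p by apply: sub_path pth => x y /and3P[].
suff IH u : connect up t u || connect down t u -> path G u p ->
    connect up t (last u p) || connect down t (last u p).
  by apply: IH pth; rewrite connect0.
elim: p u {pth} => //= w p IHp u /orP conn_u /andP[uw pth].
by apply: IHp pth; case: conn_u => [/up_step | /down_step]; apply.
Qed.

Lemma up_le u v : connect up u v -> u <= v.
Proof.
case/connectP=> p; elim: p u => [|w p IHp] u /=; first by move=> _ ->.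
by move=> /andP[/andP[_ lt_uw] pth] def_v;
    apply: leq_trans (ltnW lt_uw) (IHp w pth def_v).
Qed.

Lemma down_ge u v : connect down u v -> v <= u.
Proof.
case/connectP=> p; elim: p u => [|w p IHp] u /=; first by move=> _ ->.
by move=> /andP[/andP[_ lt_uw] pth] def_v;
    apply: leq_trans (IHp w pth def_v) (ltnW lt_uw).
Qed.

(** A monotone path between consecutive labels is a single edge. *)
Lemma adj_succ i j : i.+1 = j :> nat -> G i j.
Proof.
move=> def_j; have /orP[|/down_ge] := monotone_connect i j; last first.
  by rewrite -def_j ltnn.
case/connectP=> -[|w p] /=; first by move=> _ eq_ji; move: def_j;
    rewrite eq_ji => /esym/n_Sn.
case/andP=> /andP[iw lt_iw] pth def_w.
have le_wj : w <= j by apply: up_le; apply/connectP; exists p.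
have -> // : j = w; apply: val_inj; apply/eqP; rewrite eqn_leq le_wj andbT.
by apply: leq_trans lt_iw; rewrite def_j.
Qed.

(** Shrink the interval one label at a time from either end: the other
end and the next label inwards lie on the same side of the end that is moved. *)
Lemma adj_interval i j i' j' : G i j -> i <= i' -> i' < j' -> j' <= j -> G i' j'.
Proof.
move=> ij le_i lt_ij le_j.
have {ij le_j} ij' : G i j'.
  have lt_ij' := leq_ltn_trans le_i lt_ij.
  have [d] := ubnP (j - j'); elim: d j ij le_j => // d IHd j ij le_j;
      rewrite ltnS => le_d.
  have [eq_j|lt_j] := eqVneq (j' : nat) j; first by rewrite (val_inj eq_j).
  have {lt_j le_j}lt_j : j' < j by rewrite ltn_neqAle lt_j.
  have lt_pj : j.-1 < n by apply: leq_ltn_trans (leq_pred j) _.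
  pose j1 := Ordinal lt_pj.
  have j_gt0 : 0 < j by apply: leq_trans lt_j.
  have j1K : j1.+1 = j :> nat by rewrite /= prednK.
  have le_jj1 : j' <= j1 by rewrite -ltnS j1K.
  apply: (IHd j1) => //; last by apply: leq_trans le_d;
      rewrite -[X in _ < X - _]j1K subSn.
  apply: (G_closed (i := j)).
  - by rewrite -(inj_eq val_inj) neq_ltn (leq_trans lt_ij' le_jj1).
  - by rewrite adj_sym.
  - by rewrite adj_sym; apply: adj_succ.
  by rewrite -j1K !ltnS leqnn andbT (leq_trans (ltnW lt_ij') le_jj1) orbT.
have [d] := ubnP (i' - i); elim: d i ij' le_i => // d IHd i ij' le_i;
    rewrite ltnS => le_d.
have [eq_i|lt_i] := eqVneq (i : nat) i'; first by rewrite -(val_inj eq_i).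
have {lt_i le_i}lt_i : i < i' by rewrite ltn_neqAle lt_i.
have lt_i1 : i.+1 < n by apply: leq_ltn_trans lt_i _.
pose i1 := Ordinal lt_i1.
apply: (IHd i1) => //; last by apply: leq_trans le_d; rewrite /= ltn_sub2l.
apply: (G_closed (i := i)) => //.
- by rewrite -(inj_eq val_inj) neq_ltn /= (leq_ltn_trans lt_i lt_ij).
- exact: adj_succ.
by rewrite /= leqnn (ltn_trans lt_i lt_ij).
Qed.

Lemma initial_closed_staircase : staircase (initial_closed G).
Proof.
split=> //= [i | i i' j j' /andP[lt_ij ij]].
  by rewrite ltnSn; apply: adj_succ.
split=> // le_i le_ij le_j; rewrite ltnS le_ij /=.
by apply: adj_interval ij _ _ _; rewrite /= ?ltnS.
Qed.

End ClosedGraph.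

(** * Betti numbers of edge ideals *)

Lemma pd_ge (k : fieldType) (m : nat)
    (I : {mpoly k[m]} -> Prop) (F : min_resolution I) i j :
  betti F i j != 0 -> i <= pd F.
Proof.
rewrite -lt0n card_gt0 => /set0Pn[a _].
have rk_i : rank F i != 0 by rewrite -lt0n; apply: leq_ltn_trans (ltn_ord a).
have le_i : i < (len F).+1.
  by rewrite ltnS leqNgt; apply/negP => /rank_len rk0; rewrite rk0 in rk_i.
exact: (leq_bigmax_cond (Ordinal le_i)).
Qed.

Section EdgeIdealBetti.
Variables (k : fieldType) (V : finType) (H : sgraph V).
Variable (F : min_resolution (@edge_ideal k V H)).

Let I0 : edge_ideal H (0 : {mpoly k[#|V|]}).
Proof. by apply/edge_idealP; apply: supported0. Qed.

Let ID (p q : {mpoly k[#|V|]}) : edge_ideal H p -> edge_ideal H q ->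
    edge_ideal H (p + q)%R.
Proof. by move=> /edge_idealP Ip /edge_idealP Iq; apply/edge_idealP;
    apply: supportedD. Qed.

Let IM (p q : {mpoly k[#|V|]}) : edge_ideal H q -> edge_ideal H (p * q)%R.
Proof.
move=> /edge_idealP Iq; apply/edge_idealP;
    apply: (supportedM (Q1 := fun _ => True)) Iq => //.
by move=> m1 m2 _; rewrite addmC; apply: killedD.
Qed.

Let I_extract Q (p : {mpoly k[#|V|]}) : edge_ideal H p ->
    edge_ideal H (extract Q 0%MM p).
Proof.
move=> /edge_idealP Ip; apply/edge_idealP; apply: supported_extract Ip => m _.
by rewrite addm0.
Qed.

Lemma edge_betti_neq0 i j (z : {set V} -> {mpoly k[#|V|]}) :
    (forall A : {set V}, supported (fun m => #|A| = i /\ mdeg m + i = j) (z A)) ->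
    (forall A : {set V}, supported (killed H [set: V]) (koszulR [set: V] z A)) ->
    ~ (exists b, forall A : {set V},
         supported (killed H [set: V]) (z A - koszulR [set: V] b A)%R) ->
  betti F i j != 0.
Proof.
move=> deg_z Iz nb; apply: (betti_of_koszul F I0 ID IM I_extract deg_z) => [A|[b Ib]].
  exact/edge_idealP.
by case: nb; exists b => A; apply/edge_idealP.
Qed.

Lemma edge_betti_eq0 r i j :
  koszul_vanish k H [set: V] r -> i + r < j -> betti F i j = 0.
Proof.
move=> van lt_j; apply: (betti_eq0_of_koszul F I0 ID IM) => z deg_z Iz.
have def_d : (j - i).-1.+1 = j - i by rewrite prednK // subn_gt0 (leq_ltn_trans _
    lt_j) ?leq_addr.
have [|||b _ bad_b] := van (j - i).-1 z.
- by rewrite -ltnS def_d ltn_subRL.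
- by move=> A m /deg_z[_ def_j]; rewrite def_d -def_j addnK.
- by move=> A; apply/edge_idealP.
by exists b => A; apply/edge_idealP.
Qed.

End EdgeIdealBetti.

Theorem theorem3p6 (k : fieldType) (n : nat) (G : sgraph 'I_n)
    (n_ge2 : 2 <= n) (G_closed : closed_graph G) (G_conn : connected G)
    (G_nocut : forall v : 'I_n, ~ cut_point G v)
    (F : min_resolution (@edge_ideal k _ (initial_closed G))) :
  let H := initial_closed G in
  let U := (algorithm H).1 in
  let S := (algorithm H).2 in
  [/\ betti F (2 * (n - 1) - #|U| - #|S|) (2 * (n - 1) - #|S|) != 0,
      is_reg F (#|U|)%:Z,
      im H = #|U| &
      2 * (n - 1) - (#|U| + #|S|) <= pd F].
Proof.
move=> H U S.
have stairH : staircase H := initial_closed_staircase G_closed G_conn.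
have o : 'I_n.-1 by apply: (Ordinal (n := n.-1) (m := 0)); rewrite ltn_predRL.
have [N [bl [al [be dec]]]] := algorithmP stairH o.
have [indU cardU] := dec_matching stairH dec.
rewrite -/H -/U -/S in dec indU cardU.
have [_ xS bl_lt al_n be_n _ joined apart max_M] := dec.
have imE : im H = #|U|.
  apply/eqP; rewrite eqn_leq (leq_bigmax_cond _ indU) andbT cardU.
  by apply/bigmax_leqP => M indM; apply: max_M => // e _; apply: subsetT.
(* The bidegree of the block cycle on the complement of [S] is the claimed one. *)
pose sig := ~: S.
have card_sig : #|sig| = 2 * (n - 1) - #|S|.
  by rewrite cardsCs setCK card_sum card_ord addnn mul2n subn1.
have le_N : N <= #|sig|.
  have <- : #|[set (inl (al t) : 'I_n.-1 + 'I_n.-1) | t : 'I_N]| = N.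
    rewrite card_imset ?card_ord // => t t' eq_t; apply: val_inj => /=.
    have [_ <-] := al_n t (ltn_ord t); rewrite eq_t.
    by have [_ ->] := al_n t' (ltn_ord t').
  by apply/subset_leq_card/subsetP => v /imsetP[t _ ->]; rewrite inE.
have nz : betti F (2 * (n - 1) - #|U| - #|S|) (2 * (n - 1) - #|S|) != 0.
  rewrite subnAC -card_sig cardU.
  pose X : {set 'I_n.-1 + 'I_n.-1} := [set v | if v is inl _ then true else false].
  pose al' t : 'I_n.-1 + 'I_n.-1 := inl (al t).
  pose be' t : 'I_n.-1 + 'I_n.-1 := inr (be t).
  have sigP v : v \in sig -> v \in [set: _] :\: S by rewrite !inE andbT.
  have lt_sig : {in sig, forall v, bl v < N} by move=> v /sigP/bl_lt.
  have alP t : t < N -> [/\ al' t \in sig, al' t \in X & bl (al' t) = t].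
    by move=> /al_n[_ ?]; rewrite !inE xS.
  have beP t : t < N -> [/\ be' t \in sig, be' t \notin X & bl (be' t) = t].
    by move=> /be_n[/setDP[_ ?] ?]; rewrite !inE.
  have join : {in sig &, forall x y, x \in X -> y \notin X -> bl x = bl y -> H x y}.
    move=> [i|j] [i'|j'] xs ys; rewrite !inE // => _ _.
    by apply: joined; [rewrite inE | apply: sigP].
  apply: (@edge_betti_neq0 _ _ _ F _ _ (block_cycle k sig X bl N)).
  - exact: block_cycle_deg.
  - exact: block_cycle_closed lt_sig join.
  apply: (block_cycle_nonboundary lt_sig alP beP) => v w.
  rewrite !in_set => /andP[vs vP] /andP[ws wP] neq_bl.
  have bv : bl v < N by apply: lt_sig; rewrite in_setC.
  have bw : bl w < N by apply: lt_sig; rewrite in_setC.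
  case/orP: vP => /eqP ->; case/orP: wP => /eqP ->; rewrite /al' /be'.
  - by have [/(_ (al (bl v)) (al (bl w)))] := stairH.
  - exact: apart.
  - by rewrite adj_sym; apply: apart; rewrite // eq_sym.
  - by have [_ /(_ (be (bl v)) (be (bl w)))] := stairH.
split=> //; last by rewrite subnDA; apply: pd_ge nz.
split.
  exists (2 * (n - 1) - #|U| - #|S|), (2 * (n - 1) - #|S|); split=> //.
  by rewrite subnAC -card_sig cardU -subzn // opprB addrCA subrr addr0.
move=> i j nz_ij; have [lt_j|le_j] := ltnP (i + N) j; last first.
  by rewrite Num.Theory.lerBlDl cardU -PoszD lez_nat.
have := edge_betti_eq0 F _ lt_j; move/eqP: nz_ij => nz_ij /(_ _)/nz_ij[].
apply: koszul_vanish_matching; first exact: staircase_peelable.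
by move=> M indM _; apply: max_M => // e _; apply: subsetT.
Qed.
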